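(* There is an algorithm that, for every instance of the rescheduling problem $(1, h_1 \mid \Delta_{\max}\le k \mid \mu\Delta_{\max} + \sum_{j=1}^n w_j C_j)$ described in the context that admits a feasible schedule, computes an optimal schedule in time $O(n^3 T_1 w_{\max} (T_2 + P))$, where $w_{\max}=\max_j w_j$ and $P=\sum_j p_j$.
   Context: An instance consists of $n$ jobs $J_1,\dots,J_n$, where $J_j$ has a positive integer processing time $p_j$ and positive integer weight $w_j$, indexed so that $p_1/w_1\le\cdots\le p_n/w_n$; integers $0\le T_1<T_2$ (machine unavailable during $[T_1,T_2]$); an integer $k$; a rational $\mu\ge0$. The original schedule $\pi^*$ processes $J_1,\dots,J_n$ in order consecutively from time $0$ without idling, so $S_j(\pi^* )=\sum_{i<j}p_i$, $C_j(\pi^* )=\sum_{i\le j}p_i$. A schedule $\sigma$ gives start times $S_j(\sigma)\ge0$, non-preemptive single-machine processing, $C_j(\sigma)=S_j(\sigma)+p_j$, no overlaps, and each job has $C_j(\sigma)\le T_1$ or $S_j(\sigma)\ge T_2$. $\Delta_j=|C_j(\sigma)-C_j(\pi^* )|$, $\Delta_{\max}=\max_j\Delta_j$. Feasible means $\Delta_{\max}\le k$; optimal means feasible and minimizing $\mu\Delta_{\max}+\sum_j w_jC_j(\sigma)$. Standing assumptions: some job has $C_j(\pi^* )>T_1$; with $j_1$ the smallest such index, $\min_jp_j\le T_1<P$ and $T_2-S_{j_1}(\pi^* )\le k$. *)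

(* Defs.v *)
From Stdlib Require Import ZArith QArith Reals List Lia Lra.
Open Scope Z_scope.

(* Instances.  Jobs are 0-indexed: job j (0 <= j < n) is the paper's   *)
(* J_{j+1}.  Values of p, w at indices >= n are irrelevant.            *)
Record instance := {
  n_jobs : nat;
  proc : nat -> Z;
  wgt : nat -> Z;
  T1 : Z;
  T2 : Z;
  kbound : Z;
  mu : Q
}.

Fixpoint zsum (f : nat -> Z) (m : nat) : Z :=
  match m with O => 0 | S m' => zsum f m' + f m' end.

Fixpoint zmaxn (f : nat -> Z) (m : nat) : Z :=
  match m with O => 0 | S m' => Z.max (zmaxn f m') (f m') end.

(* S_j and C_j in the original schedule pi-star *)
Definition Sstar (I : instance) (j : nat) : Z := zsum (proc I) j.
Definition Cstar (I : instance) (j : nat) : Z := zsum (proc I) (S j).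
Definition Ptot (I : instance) : Z := zsum (proc I) (n_jobs I).
Definition wmax (I : instance) : Z := zmaxn (wgt I) (n_jobs I).

Definition valid_instance (I : instance) : Prop :=
  (forall j, (j < n_jobs I)%nat -> 0 < proc I j /\ 0 < wgt I j) /\
  (* WSPT indexing: p_j / w_j <= p_{j+1} / w_{j+1} *)
  (forall j, (S j < n_jobs I)%nat ->
      proc I j * wgt I (S j) <= proc I (S j) * wgt I j) /\
  0 <= T1 I < T2 I /\
  (0 <= mu I)%Q /\
  (exists j, (j < n_jobs I)%nat /\ Cstar I j > T1 I) /\
  (exists j, (j < n_jobs I)%nat /\ proc I j <= T1 I) /\
  T1 I < Ptot I /\
  (forall j1, (j1 < n_jobs I)%nat -> Cstar I j1 > T1 I ->
     (forall i, (i < j1)%nat -> Cstar I i <= T1 I) ->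
     T2 I - Sstar I j1 <= kbound I).

Open Scope R_scope.

Fixpoint Rsumn (f : nat -> R) (m : nat) : R :=
  match m with O => 0 | S m' => Rsumn f m' + f m' end.

Fixpoint Rmaxn (f : nat -> R) (m : nat) : R :=
  match m with O => 0 | S m' => Rmax (Rmaxn f m') (f m') end.

Definition Cj (I : instance) (sigma : nat -> R) (j : nat) : R :=
  sigma j + IZR (proc I j).

Definition is_schedule (I : instance) (sigma : nat -> R) : Prop :=
  (forall j, (j < n_jobs I)%nat -> 0 <= sigma j) /\
  (forall i j, (i < n_jobs I)%nat -> (j < n_jobs I)%nat -> i <> j ->
     Cj I sigma i <= sigma j \/ Cj I sigma j <= sigma i) /\
  (forall j, (j < n_jobs I)%nat ->
     Cj I sigma j <= IZR (T1 I) \/ IZR (T2 I) <= sigma j).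

Definition Delta (I : instance) (sigma : nat -> R) (j : nat) : R :=
  Rabs (Cj I sigma j - IZR (Cstar I j)).

Definition Delta_max (I : instance) (sigma : nat -> R) : R :=
  Rmaxn (Delta I sigma) (n_jobs I).

Definition feasible (I : instance) (sigma : nat -> R) : Prop :=
  is_schedule I sigma /\ Delta_max I sigma <= IZR (kbound I).

Definition objective (I : instance) (sigma : nat -> R) : R :=
  Q2R (mu I) * Delta_max I sigma
  + Rsumn (fun j => IZR (wgt I j) * Cj I sigma j) (n_jobs I).

Definition optimal (I : instance) (sigma : nat -> R) : Prop :=
  feasible I sigma /\
  forall tau, feasible I tau -> objective I sigma <= objective I tau.

Close Scope R_scope.

(* Machine model: unit-cost RAM with integer registers and an integer- *)
(* addressed integer memory.  Each executed instruction costs 1.       *)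
Inductive instr :=
| Iconst (d : nat) (z : Z)
| Iadd (d a b : nat)
| Isub (d a b : nat)
| Imul (d a b : nat)
| Iload (d a : nat)
| Istore (a s : nat)
| Ijlt (a b : nat) (l : nat)
| Ijmp (l : nat)
| Ihalt.

Record mstate := { pc : nat; reg : nat -> Z; mem : Z -> Z }.

Definition upd_reg (r : nat -> Z) (d : nat) (v : Z) : nat -> Z :=
  fun x => if Nat.eqb x d then v else r x.
Definition upd_mem (m : Z -> Z) (a : Z) (v : Z) : Z -> Z :=
  fun x => if Z.eqb x a then v else m x.

Definition step (prog : list instr) (s : mstate) : option mstate :=
  let r := reg s in let m := mem s in let nx := S (pc s) in
  match nth_error prog (pc s) with
  | None => None
  | Some Ihalt => None
  | Some (Iconst d z) => Some {| pc := nx; reg := upd_reg r d z; mem := m |}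
  | Some (Iadd d a b) => Some {| pc := nx; reg := upd_reg r d (r a + r b); mem := m |}
  | Some (Isub d a b) => Some {| pc := nx; reg := upd_reg r d (r a - r b); mem := m |}
  | Some (Imul d a b) => Some {| pc := nx; reg := upd_reg r d (r a * r b); mem := m |}
  | Some (Iload d a) => Some {| pc := nx; reg := upd_reg r d (m (r a)); mem := m |}
  | Some (Istore a v) => Some {| pc := nx; reg := r; mem := upd_mem m (r a) (r v) |}
  | Some (Ijlt a b l) =>
      Some {| pc := if Z.ltb (r a) (r b) then l else nx; reg := r; mem := m |}
  | Some (Ijmp l) => Some {| pc := l; reg := r; mem := m |}
  end.

Inductive halts_in (prog : list instr) : nat -> mstate -> mstate -> Prop :=
| halts_now : forall s, step prog s = None -> halts_in prog O s s
| halts_step : forall t s s' f, step prog s = Some s' ->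
    halts_in prog t s' f -> halts_in prog (S t) s f.

Definition input_mem (I : instance) : Z -> Z := fun a =>
  if Z.eqb a 0 then Z.of_nat (n_jobs I)
  else if Z.eqb a 1 then T1 I
  else if Z.eqb a 2 then T2 I
  else if Z.eqb a 3 then kbound I
  else if Z.eqb a 4 then Qnum (mu I)
  else if Z.eqb a 5 then Zpos (Qden (mu I))
  else if (6 <=? a) && (a <? 6 + 2 * Z.of_nat (n_jobs I)) then
    (if Z.even a then proc I (Z.to_nat ((a - 6) / 2))
     else wgt I (Z.to_nat ((a - 6) / 2)))
  else 0.

Definition init_state (I : instance) : mstate :=
  {| pc := O; reg := fun _ => 0; mem := input_mem I |}.

Definition output_schedule (f : mstate) : nat -> R :=
  fun j => IZR (mem f (Z.of_nat j)).

Definition time_bound (I : instance) : Z :=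
  Z.of_nat (n_jobs I) ^ 3 * T1 I * wmax I * (T2 I + Ptot I).

(* Main.v *)
(** Given an early set E and a bound D on the deviation, the late jobs run in
    index order from T2, so the first late job has the largest delay, and the
    early job j completes at best at max(X, Cstar j - D), where X is the total
    length of the early jobs up to j.  For the lower bound, Cstar j - X grows
    with j: below a threshold Smith's rule bounds the weighted completion times,
    above it the deviation bound does.  These costs are affine in D between
    consecutive integers, so an integer D suffices, and D <= T2 + P.
    For fixed D the only state of a dynamic program over the jobs is the total
    length of the early jobs so far, at most T1; this costs O(n T1) per D and
    O(n T1 (T2 + P)) overall. *)

Require Import Defs.
From Stdlib Require Import ZArith QArith Reals List Lia Lra Bool Qreals.
Import ListNotations.
Open Scope Z_scope.

(** * Structured programs compiled to the RAM *)

(** A plan is an early set with an integer [D] that bounds the deviation and need not equal it. This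
    lets the two halves meet: an admissible plan gives a schedule whose objective is at most the
    cost of the plan, and a feasible schedule costs at least as much as the plan built from its own
    early set and deviation. Start times are real, so that deviation may be fractional, and the
    second half is proved for real [D] before rounding. The obstacle is the idle time that a
    deviation bound forces among the early jobs: it threatens to add the current time to the state.
    It does not, because Sstar j - X, with X the early load before j, is the total length of the
    late jobs before j and never decreases. Waiting for an earlier release time thus never pushes an
    early job past its own release time Sstar j - D, and its start is the maximum of that and X,
    with no recursion over earlier start times. *)

Inductive cmd :=
| Do (l : list instr)
| Seq (c1 c2 : cmd)
| If (a b : nat) (c1 c2 : cmd)
| While (a b : nat) (c : cmd).

(** The else branch comes first because a failed [Ijlt] falls through to the next instruction. Jump
    targets are absolute, hence the offset [o]. *)
Fixpoint compile (c : cmd) (o : nat) : list instr :=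
  match c with
  | Do l => l
  | Seq c1 c2 => compile c1 o ++ compile c2 (o + length (compile c1 o))
  | If a b c1 c2 =>
      let k2 := compile c2 (S o) in
      let o1 := (o + 2 + length k2)%nat in
      let k1 := compile c1 o1 in
      Ijlt a b o1 :: k2 ++ Ijmp (o1 + length k1) :: k1
  | While a b c =>
      let k := compile c (o + 2) in
      Ijlt a b (o + 2) :: Ijmp (o + 3 + length k) :: k ++ [Ijmp o]
  end.

Definition store := ((nat -> Z) * (Z -> Z))%type.

Definition straight (i : instr) : bool :=
  match i with Ijlt _ _ _ | Ijmp _ | Ihalt => false | _ => true end.

Definition effect (s : store) (i : instr) : store :=
  let (r, m) := s in
  match i with
  | Iconst d z => (upd_reg r d z, m)
  | Iadd d a b => (upd_reg r d (r a + r b), m)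
  | Isub d a b => (upd_reg r d (r a - r b), m)
  | Imul d a b => (upd_reg r d (r a * r b), m)
  | Iload d a => (upd_reg r d (m (r a)), m)
  | Istore a v => (r, upd_mem m (r a) (r v))
  | _ => s
  end.

(** The number is the exact instruction count of the compiled code: an else branch pays for the jump
    over the then branch, a loop exit for the failed test and the exit jump, an iteration for the
    test and the jump back. *)
Inductive exec : cmd -> store -> nat -> store -> Prop :=
| exec_do l s : forallb straight l = true ->
    exec (Do l) s (length l) (fold_left effect l s)
| exec_seq c1 c2 s1 s2 s3 t1 t2 :
    exec c1 s1 t1 s2 -> exec c2 s2 t2 s3 -> exec (Seq c1 c2) s1 (t1 + t2) s3
| exec_if_true a b c1 c2 s s' t :
    (fst s a <? fst s b) = true -> exec c1 s t s' ->
    exec (If a b c1 c2) s (S t) s'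
| exec_if_false a b c1 c2 s s' t :
    (fst s a <? fst s b) = false -> exec c2 s t s' ->
    exec (If a b c1 c2) s (S (t + 1)) s'
| exec_while_end a b c s :
    (fst s a <? fst s b) = false -> exec (While a b c) s 2 s
| exec_while_step a b c s1 s2 s3 t1 t2 :
    (fst s1 a <? fst s1 b) = true -> exec c s1 t1 s2 ->
    exec (While a b c) s2 t2 s3 ->
    exec (While a b c) s1 (S (t1 + S t2)) s3.

Definition at_pc (o : nat) (s : store) : mstate :=
  {| pc := o; reg := fst s; mem := snd s |}.

Inductive runs (prog : list instr) : nat -> mstate -> mstate -> Prop :=
| runs_refl s : runs prog 0 s s
| runs_step t s s' s'' : step prog s = Some s' -> runs prog t s' s'' ->
    runs prog (S t) s s''.

Lemma runs_trans prog t1 t2 s1 s2 s3 :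
  runs prog t1 s1 s2 -> runs prog t2 s2 s3 -> runs prog (t1 + t2) s1 s3.
Proof.
  induction 1; intros; simpl; [assumption|].
  econstructor; eauto.
Qed.

Lemma runs_halts prog t s s' :
  runs prog t s s' -> step prog s' = None -> halts_in prog t s s'.
Proof.
  induction 1; intros; [constructor; assumption|].
  econstructor; eauto.
Qed.

Lemma fetch (pre post : list instr) i o s :
  o = length pre ->
  nth_error (pre ++ i :: post) (pc (at_pc o s)) = Some i.
Proof.
  intros ->. cbn. rewrite nth_error_app2 by lia.
  now rewrite Nat.sub_diag.
Qed.

Lemma step_straight pre i post o s :
  o = length pre -> straight i = true ->
  step (pre ++ i :: post) (at_pc o s) = Some (at_pc (S o) (effect s i)).
Proof.
  intros Ho Hi. unfold step. rewrite fetch by assumption.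
  destruct s as [r m]; destruct i; try discriminate; reflexivity.
Qed.

Lemma step_jlt pre a b l post o s :
  o = length pre ->
  step (pre ++ Ijlt a b l :: post) (at_pc o s)
  = Some (at_pc (if fst s a <? fst s b then l else S o) s).
Proof.
  intros Ho. unfold step. rewrite fetch by assumption. reflexivity.
Qed.

Lemma step_jmp pre l post o s :
  o = length pre ->
  step (pre ++ Ijmp l :: post) (at_pc o s) = Some (at_pc l s).
Proof.
  intros Ho. unfold step. rewrite fetch by assumption. reflexivity.
Qed.

Lemma runs_straight l : forall pre post o s prog,
  prog = pre ++ l ++ post -> o = length pre -> forallb straight l = true ->
  runs prog (length l) (at_pc o s) (at_pc (o + length l) (fold_left effect l s)).
Proof.
  induction l as [|i l IH]; intros pre post o s prog -> Ho Hl; simpl in *.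
  - rewrite Nat.add_0_r. constructor.
  - apply andb_prop in Hl as [Hi Hl].
    econstructor; [now apply step_straight|].
    replace (o + S (length l))%nat with (S o + length l)%nat by lia.
    apply IH with (pre := pre ++ [i]) (post := post); auto.
    + now rewrite <- app_assoc.
    + rewrite length_app. simpl. lia.
Qed.

(** The code sits between arbitrary [pre] and [post], so that the induction applies to each
    subprogram inside the same program. *)
Lemma compile_runs c s t s' : exec c s t s' ->
  forall prog pre post o,
  prog = pre ++ compile c o ++ post -> o = length pre ->
  runs prog t (at_pc o s) (at_pc (o + length (compile c o)) s').
Proof.
  induction 1 as [l s Hl|c1 c2 s1 s2 s3 t1 t2 _ IH1 _ IH2
    |a b c1 c2 s s' t Hlt _ IH|a b c1 c2 s s' t Hlt _ IH
    |a b c s Hlt|a b c s1 s2 s3 t1 t2 Hlt _ IH1 _ IH2];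
    intros prog pre post o Hp Ho.
  - now apply (runs_straight l pre post).
  - cbn [compile] in *. set (k1 := compile c1 o) in *.
    set (k2 := compile c2 (o + length k1)) in *.
    apply runs_trans with (at_pc (o + length k1) s2).
    + apply (IH1 _ pre (k2 ++ post)); [|assumption].
      now rewrite Hp, <- app_assoc.
    + rewrite length_app, Nat.add_assoc.
      apply (IH2 _ (pre ++ k1) post).
      * now rewrite Hp, <- !app_assoc.
      * rewrite length_app. lia.
  - cbn [compile] in *. set (k2 := compile c2 (S o)) in *.
    set (o1 := (o + 2 + length k2)%nat) in *. set (k1 := compile c1 o1) in *.
    econstructor.
    { rewrite Hp. cbn [app]. now apply step_jlt. }
    rewrite Hlt.
    replace (o + _)%nat with (o1 + length k1)%nat
      by (simpl; rewrite length_app; simpl; lia).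
    apply (IH _ (pre ++ Ijlt a b o1 :: k2 ++ [Ijmp (o1 + length k1)]) post).
    + rewrite Hp. repeat (rewrite <- app_assoc; cbn [app]). reflexivity.
    + rewrite length_app; simpl; rewrite length_app; simpl. lia.
  - cbn [compile] in *. set (k2 := compile c2 (S o)) in *.
    set (o1 := (o + 2 + length k2)%nat) in *. set (k1 := compile c1 o1) in *.
    econstructor.
    { rewrite Hp. cbn [app]. now apply step_jlt. }
    rewrite Hlt. apply runs_trans with (at_pc (S o + length k2) s').
    + apply (IH _ (pre ++ [Ijlt a b o1]) (Ijmp (o1 + length k1) :: k1 ++ post)).
      * rewrite Hp. repeat (rewrite <- app_assoc; cbn [app]). reflexivity.
      * rewrite length_app; simpl. lia.
    + econstructor; [|constructor].
      replace prog with ((pre ++ Ijlt a b o1 :: k2)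
        ++ Ijmp (o1 + length k1) :: k1 ++ post)
        by (rewrite Hp; repeat (rewrite <- app_assoc; cbn [app]); reflexivity).
      rewrite step_jmp by (rewrite length_app; simpl; lia).
      do 2 f_equal. simpl; rewrite length_app; simpl. lia.
  - cbn [compile] in *. set (k := compile c (o + 2)) in *.
    econstructor.
    { rewrite Hp. cbn [app]. now apply step_jlt. }
    rewrite Hlt. econstructor; [|constructor].
    replace prog with ((pre ++ [Ijlt a b (o + 2)])
      ++ Ijmp (o + 3 + length k) :: k ++ [Ijmp o] ++ post)
      by (rewrite Hp; repeat (rewrite <- app_assoc; cbn [app]); reflexivity).
    rewrite step_jmp by (rewrite length_app; simpl; lia).
    do 2 f_equal. simpl; rewrite length_app; simpl. lia.
  - pose proof (IH2 prog pre post o Hp Ho) as IH.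
    cbn [compile] in *. set (k := compile c (o + 2)) in *.
    econstructor.
    { rewrite Hp. cbn [app]. now apply step_jlt. }
    rewrite Hlt. apply runs_trans with (at_pc (o + 2 + length k) s2).
    + apply (IH1 _ (pre ++ [Ijlt a b (o + 2); Ijmp (o + 3 + length k)])
               ([Ijmp o] ++ post)).
      * rewrite Hp. repeat (rewrite <- app_assoc; cbn [app]). reflexivity.
      * rewrite length_app; simpl. lia.
    + econstructor; [|exact IH].
      replace prog with ((pre ++ Ijlt a b (o + 2) :: Ijmp (o + 3 + length k) :: k)
        ++ Ijmp o :: post)
        by (rewrite Hp; repeat (rewrite <- app_assoc; cbn [app]); reflexivity).
      apply step_jmp. rewrite length_app; simpl; lia.
Qed.

(** No [Ihalt] is emitted: execution stops because the program counter runs past the last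
    instruction. *)
Lemma compile_halts c s t s' : exec c s t s' ->
  halts_in (compile c 0) t (at_pc 0 s) (at_pc (length (compile c 0)) s').
Proof.
  intros H. apply runs_halts.
  - apply (compile_runs c s t s' H _ [] []); [|reflexivity].
    now rewrite app_nil_r.
  - unfold step. cbn [pc at_pc].
    now rewrite (proj2 (nth_error_None _ _)) by lia.
Qed.

(** * Total correctness with a time bound *)

Definition within (c : cmd) (s : store) (T : Z) (Q : store -> Prop) : Prop :=
  exists t s', exec c s t s' /\ Z.of_nat t <= T /\ Q s'.

Lemma within_weaken c s T T' (Q Q' : store -> Prop) :
  within c s T Q -> T <= T' -> (forall s', Q s' -> Q' s') -> within c s T' Q'.
Proof.
  intros (t & s' & He & Ht & HQ) HT HQQ.
  exists t, s'. repeat split; auto. lia.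
Qed.

Lemma within_do l s T (Q : store -> Prop) :
  forallb straight l = true -> Z.of_nat (length l) <= T ->
  Q (fold_left effect l s) -> within (Do l) s T Q.
Proof. intros. eexists _, _. repeat split; eauto using exec. Qed.

Lemma within_seq T U (R : store -> Prop) c1 c2 s V (Q : store -> Prop) :
  T + U <= V ->
  within c1 s T R -> (forall s', R s' -> within c2 s' U Q) ->
  within (Seq c1 c2) s V Q.
Proof.
  intros HV (t & s1 & He & Ht & HR) H2.
  destruct (H2 _ HR) as (t2 & s2 & He2 & Ht2 & HQ).
  exists (t + t2)%nat, s2. repeat split; [econstructor; eauto| lia | assumption].
Qed.

Lemma within_if T a b c1 c2 s U (Q : store -> Prop) :
  T + 2 <= U ->
  (fst s a < fst s b -> within c1 s T Q) ->
  (fst s b <= fst s a -> within c2 s T Q) ->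
  within (If a b c1 c2) s U Q.
Proof.
  intros HU H1 H2. destruct (Z.ltb_spec (fst s a) (fst s b)) as [Hlt|Hge].
  - destruct (H1 Hlt) as (t & s' & He & Ht & HQ).
    exists (S t), s'. repeat split; [|lia|assumption].
    apply exec_if_true; [now apply Z.ltb_lt|assumption].
  - destruct (H2 Hge) as (t & s' & He & Ht & HQ).
    exists (S (t + 1)), s'. repeat split; [|lia|assumption].
    apply exec_if_false; [now apply Z.ltb_ge|assumption].
Qed.

(** [Inv] is indexed by the iteration number, so the loop runs exactly [k] times. The 2 added to [T]
    is the test and the jump back, the final 2 is the exit. *)
Lemma within_while (Inv : nat -> store -> Prop) a b c T :
  forall k i s, Inv i s ->
  (forall j s', (i <= j < i + k)%nat -> Inv j s' ->
     fst s' a < fst s' b /\ within c s' T (Inv (S j))) ->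
  (forall s', Inv (i + k)%nat s' -> fst s' b <= fst s' a) ->
  within (While a b c) s (Z.of_nat k * (T + 2) + 2) (Inv (i + k)%nat).
Proof.
  induction k as [|k IH]; intros i s HI Hstep Hend.
  - rewrite Nat.add_0_r in *. exists 2%nat, s. repeat split; [|lia|assumption].
    apply exec_while_end, Z.ltb_ge, Hend, HI.
  - destruct (Hstep i s ltac:(lia) HI) as (Hlt & t & s' & He & Ht & HI').
    replace (i + S k)%nat with (S i + k)%nat in * by lia.
    destruct (IH (S i) s' HI') as (t' & s'' & He' & Ht' & HQ).
    + intros j s1 Hj. apply Hstep. lia.
    + exact Hend.
    + exists (S (t + S t')), s''. repeat split; [|lia|assumption].
      eapply exec_while_step; eauto. now apply Z.ltb_lt.
Qed.

(** * Schedules with a given early set *)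

Lemma zsum_ext f g m :
  (forall j, (j < m)%nat -> f j = g j) -> zsum f m = zsum g m.
Proof.
  induction m; intros H; simpl; [reflexivity|].
  rewrite IHm by (intros; apply H; lia). now rewrite H by lia.
Qed.

Lemma zsum_le f g m :
  (forall j, (j < m)%nat -> f j <= g j) -> zsum f m <= zsum g m.
Proof.
  induction m; intros H; simpl; [lia|].
  specialize (IHm ltac:(intros; apply H; lia)). specialize (H m ltac:(lia)). lia.
Qed.

Lemma zsum_mono f i m :
  (i <= m)%nat -> (forall j, (j < m)%nat -> 0 <= f j) -> zsum f i <= zsum f m.
Proof.
  intros Him. induction Him as [|m Him IH]; intros H; simpl; [lia|].
  specialize (IH ltac:(intros; apply H; lia)). specialize (H m ltac:(lia)). lia.
Qed.

Lemma zsum_mul_r f c m : zsum (fun j => f j * c) m = zsum f m * c.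
Proof. induction m; simpl; [lia|]. rewrite IHm. lia. Qed.

Open Scope R_scope.

Lemma Rsumn_ext f g m :
  (forall j, (j < m)%nat -> f j = g j) -> Rsumn f m = Rsumn g m.
Proof.
  induction m; intros H; simpl; [reflexivity|].
  rewrite IHm by (intros; apply H; lia). now rewrite H by lia.
Qed.

Lemma Rsumn_le f g m :
  (forall j, (j < m)%nat -> f j <= g j) -> Rsumn f m <= Rsumn g m.
Proof.
  induction m; intros H; simpl; [lra|].
  specialize (IHm ltac:(intros; apply H; lia)). specialize (H m ltac:(lia)). lra.
Qed.

Lemma Rsumn_plus f g m :
  Rsumn (fun j => f j + g j) m = Rsumn f m + Rsumn g m.
Proof. induction m; simpl; lra. Qed.

Lemma Rsumn_mul_l c f m : Rsumn (fun j => c * f j) m = c * Rsumn f m.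
Proof. induction m; simpl; lra. Qed.

Lemma IZR_zsum f m : IZR (zsum f m) = Rsumn (fun j => IZR (f j)) m.
Proof. induction m; simpl; [reflexivity|]. now rewrite plus_IZR, IHm. Qed.

Lemma Rmaxn_ge f m j : (j < m)%nat -> f j <= Rmaxn f m.
Proof.
  induction m; intros H; [lia|]. simpl.
  destruct (Nat.eq_dec j m) as [->|]; [apply Rmax_r|].
  eapply Rle_trans; [apply IHm; lia|apply Rmax_l].
Qed.

Lemma Rmaxn_nonneg f m : 0 <= Rmaxn f m.
Proof.
  induction m; simpl; [lra|]. eapply Rle_trans; [exact IHm|apply Rmax_l].
Qed.

Lemma Rmaxn_le f m b :
  0 <= b -> (forall j, (j < m)%nat -> f j <= b) -> Rmaxn f m <= b.
Proof.
  intros Hb. induction m; intros H; simpl; [assumption|].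
  apply Rmax_lub; [apply IHm; intros|]; apply H; lia.
Qed.

(** * Packing and ordering inequalities for real start times *)

(* The last job cuts the interval into the part before it and the part after it. *)
Lemma packing (p s : nat -> R) : forall m (A : nat -> bool) a b,
  a <= b ->
  (forall j, (j < m)%nat -> A j = true -> a <= s j /\ s j + p j <= b) ->
  (forall i j, (i < m)%nat -> (j < m)%nat -> A i = true -> A j = true ->
     i <> j -> s i + p i <= s j \/ s j + p j <= s i) ->
  Rsumn (fun j => if A j then p j else 0) m <= b - a.
Proof.
  induction m as [|m IH]; intros A a b Hab Hin Hdis; simpl; [lra|].
  destruct (A m) eqn:Am.
  - destruct (Hin m ltac:(lia) Am) as [Ha Hb].
    set (before := fun j => if Rle_dec (s j + p j) (s m) then true else false).
    assert (H1 : Rsumn (fun j => if A j && before j then p j else 0) m <= s m - a).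
    { apply IH; [assumption| |].
      - intros j Hj [HA HB]%andb_prop. split; [apply Hin; [lia|assumption]|].
        unfold before in HB. destruct (Rle_dec _ _); [assumption|discriminate].
      - intros i j Hi Hj [HA _]%andb_prop [HA' _]%andb_prop. apply Hdis; auto. }
    assert (H2 : Rsumn (fun j => if A j && negb (before j) then p j else 0) m
                 <= b - (s m + p m)).
    { apply IH; [assumption| |].
      - intros j Hj [HA HB]%andb_prop. split; [|apply Hin; [lia|assumption]].
        unfold before in HB. destruct (Rle_dec _ _); [discriminate|].
        destruct (Hdis j m) as [H|H]; auto; try lia; lra.
      - intros i j Hi Hj [HA _]%andb_prop [HA' _]%andb_prop. apply Hdis; auto. }
    replace (Rsumn (fun j => if A j then p j else 0) m) with
      (Rsumn (fun j => (if A j && before j then p j else 0)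
         + (if A j && negb (before j) then p j else 0)) m).
    + rewrite Rsumn_plus. lra.
    + apply Rsumn_ext. intros j _. destruct (A j), (before j); simpl; lra.
  - rewrite Rplus_0_r. apply IH; auto.
Qed.

(** [b i j] says how much of job [i] is counted before job [j]. A pair contributes once on the left
    and in both orders on the right, so the pairs are compared one by one as [m] grows; diagonal
    terms on the right are merely nonnegative. *)
Lemma pairwise_order_bound (p w : nat -> R) (b : nat -> nat -> R) m :
  (forall i j, (i < m)%nat -> (j < m)%nat -> 0 <= w j * (b i j * p i)) ->
  (forall i j, (i < j)%nat -> (j < m)%nat ->
     w j * p i <= w j * (b i j * p i) + w i * (b j i * p j)) ->
  Rsumn (fun j => w j * Rsumn p j) m
  <= Rsumn (fun j => w j * Rsumn (fun i => b i j * p i) m) m.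
Proof.
  induction m as [|m IH]; intros H0 H1; simpl; [lra|].
  specialize (IH ltac:(auto) ltac:(auto)).
  rewrite (Rsumn_ext (fun j => _ * (_ + _))
    (fun j => w j * Rsumn (fun i => b i j * p i) m + w j * (b m j * p m)))
    by (intros; ring).
  rewrite Rsumn_plus.
  assert (H : w m * Rsumn p m <= w m * Rsumn (fun i => b i m * p i) m
                + Rsumn (fun j => w j * (b m j * p m)) m).
  { rewrite <- !Rsumn_mul_l, <- Rsumn_plus. apply Rsumn_le. intros; apply H1; lia. }
  specialize (H0 m m ltac:(lia) ltac:(lia)). lra.
Qed.

(* In each pair of jobs one precedes the other, and by the ratio condition the
   pair contributes least to the weighted sum when the smaller index is first. *)
Lemma smith_rule (p w s : nat -> R) m (A : nat -> bool) a :
  (forall j, (j < m)%nat -> 0 <= p j /\ 0 <= w j) ->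
  (forall i j, (i < j)%nat -> (j < m)%nat -> p i * w j <= p j * w i) ->
  (forall j, (j < m)%nat -> A j = true -> a <= s j) ->
  (forall i j, (i < m)%nat -> (j < m)%nat -> A i = true -> A j = true ->
     i <> j -> s i + p i <= s j \/ s j + p j <= s i) ->
  Rsumn (fun j => if A j
                  then w j * (a + Rsumn (fun i => if A i then p i else 0) j + p j)
                  else 0) m
  <= Rsumn (fun j => if A j then w j * (s j + p j) else 0) m.
Proof.
  intros Hpos Hratio Hstart Hdis.
  (* Zero data outside [A] turns a sum over a subset into a sum over all indices. *)
  set (p' := fun i => if A i then p i else 0).
  set (w' := fun j => if A j then w j else 0).
  set (b := fun i j => if Nat.eqb i j then 0
                       else if Rle_dec (s i + p i) (s j) then 1 else 0).
  assert (Hpw : forall j, (j < m)%nat -> 0 <= p' j /\ 0 <= w' j).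
  { intros j Hj. unfold p', w'. specialize (Hpos j Hj). destruct (A j); lra. }
  assert (Hb : forall i j, 0 <= b i j).
  { intros i j. unfold b. destruct (Nat.eqb i j); [lra|]. destruct (Rle_dec _ _); lra. }
  assert (Hpair : Rsumn (fun j => w' j * Rsumn p' j) m
    <= Rsumn (fun j => w' j * Rsumn (fun i => b i j * p' i) m) m).
  { apply pairwise_order_bound.
    - intros i j Hi Hj.
      apply Rmult_le_pos; [apply Hpw; lia|]. apply Rmult_le_pos; [apply Hb|].
      apply Hpw; lia.
    - intros i j Hij Hj. pose proof (Hpos i ltac:(lia)). pose proof (Hpos j Hj).
      pose proof (Hratio i j Hij Hj).
      assert (0 <= w j * p i) by (apply Rmult_le_pos; lra).
      assert (0 <= w i * p j) by (apply Rmult_le_pos; lra).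
      unfold w', p', b.
      replace (Nat.eqb i j) with false by (symmetry; apply Nat.eqb_neq; lia).
      replace (Nat.eqb j i) with false by (symmetry; apply Nat.eqb_neq; lia).
      destruct (A i) eqn:Ai, (A j) eqn:Aj;
        destruct (Rle_dec (s i + p i) (s j)), (Rle_dec (s j + p j) (s i)); try lra.
      destruct (Hdis i j) as [?|?]; auto; try lia; lra. }
  (* The jobs of [A] that end before [j] starts are packed into the interval from [a] to [s j]. *)
  assert (Hpack : forall j, (j < m)%nat -> A j = true ->
    a + Rsumn (fun i => b i j * p' i) m <= s j).
  { intros j Hj Aj.
    assert (H : Rsumn (fun i => if A i && negb (Nat.eqb i j)
        && (if Rle_dec (s i + p i) (s j) then true else false) then p i else 0) m
        <= s j - a).
    { apply packing with (s := s); [auto| |].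
      - intros i Hi [[HA _]%andb_prop HB]%andb_prop. split; [auto|].
        destruct (Rle_dec _ _); [assumption|discriminate].
      - intros i i' Hi Hi' [[HA _]%andb_prop _]%andb_prop
          [[HA' _]%andb_prop _]%andb_prop. auto. }
    erewrite Rsumn_ext; [|intros i Hi].
    2:{ instantiate (1 := fun i => if A i && negb (Nat.eqb i j)
          && (if Rle_dec (s i + p i) (s j) then true else false) then p i else 0).
        unfold b, p'. destruct (A i), (Nat.eqb i j); simpl; try lra.
        destruct (Rle_dec _ _); lra. }
    lra. }
  apply Rle_trans with (Rsumn (fun j => w' j * (a + p j)) m
                        + Rsumn (fun j => w' j * Rsumn p' j) m).
  - rewrite <- Rsumn_plus. apply Rsumn_le. intros j _. unfold w'.
    destruct (A j); [|lra]. apply Req_le. fold p'. ring.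
  - eapply Rle_trans; [apply Rplus_le_compat_l, Hpair|].
    rewrite <- Rsumn_plus. apply Rsumn_le. intros j Hj. unfold w'.
    destruct (A j) eqn:Aj; [|lra].
    specialize (Hpack j Hj Aj). specialize (Hpos j Hj).
    rewrite <- Rmult_plus_distr_l. apply Rmult_le_compat_l; lra.
Qed.

Close Scope R_scope.

(** * Plans: an early set with a deviation bound *)

Definition early_load (I : instance) (E : nat -> bool) (j : nat) : Z :=
  zsum (fun i => if E i then proc I i else 0) j.

(* Completion times of the best schedule with early set E and deviation bound
   D: the late jobs run without idling from T2, and once the release times
   Sstar - D force idling, every later early job starts at its release time. *)
Definition completion (I : instance) (E : nat -> bool) (D : Z) (j : nat) : Z :=
  if E j then Z.max (early_load I E j + proc I j) (Cstar I j - D)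
  else T2 I - early_load I E j + Cstar I j.

(** The delay of a late job is exactly [T2 I - early_load I E j]. For [0 <= D] an early job is never
    delayed, as its load is at most [Sstar], and the maximum in [completion] limits how early it
    ends, so only [T1] remains to be checked. *)
Definition admissible (I : instance) (E : nat -> bool) (D : Z) (j : nat) : Prop :=
  if E j then completion I E D j <= T1 I else T2 I - early_load I E j <= D.

Definition weighted (I : instance) (E : nat -> bool) (D : Z) (j : nat) : Z :=
  wgt I j * completion I E D j.

Definition total_cost (I : instance) (E : nat -> bool) (D : Z) : Z :=
  zsum (weighted I E D) (n_jobs I).

Lemma Cstar_eq I j : Cstar I j = Sstar I j + proc I j.
Proof. reflexivity. Qed.

Lemma Sstar_S I j : Sstar I (S j) = Cstar I j.
Proof. reflexivity. Qed.

Lemma early_load_S I E j :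
  early_load I E (S j) = early_load I E j + (if E j then proc I j else 0).
Proof. reflexivity. Qed.

Section Valid.

Context (I : instance) (HI : valid_instance I).

Lemma proc_pos j : (j < n_jobs I)%nat -> 0 < proc I j.
Proof. intros. now apply HI. Qed.

Lemma wgt_pos j : (j < n_jobs I)%nat -> 0 < wgt I j.
Proof. intros. now apply HI. Qed.

Lemma T1_T2 : 0 <= T1 I < T2 I.
Proof. apply HI. Qed.

Lemma wspt_ratio i j : (i < j)%nat -> (j < n_jobs I)%nat ->
  proc I i * wgt I j <= proc I j * wgt I i.
Proof.
  intros Hij. induction Hij as [|j Hij IH]; intros Hj.
  - now apply HI.
  - specialize (IH ltac:(lia)).
    pose proof (proj1 (proj2 HI) j Hj) as H.
    pose proof (wgt_pos j ltac:(lia)). pose proof (wgt_pos i ltac:(lia)).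
    pose proof (wgt_pos (S j) ltac:(lia)).
    (* Cross-multiplied ratios are chained by multiplying through by the weight of the middle
       job. *)
    apply (Z.mul_le_mono_pos_r _ _ (wgt I j)); [assumption|]. nia.
Qed.

Lemma early_load_mono E i j : (i <= j <= n_jobs I)%nat ->
  early_load I E i <= early_load I E j.
Proof.
  intros H. apply zsum_mono; [lia|]. intros m Hm.
  pose proof (proc_pos m ltac:(lia)). destruct (E m); lia.
Qed.

Lemma early_load_nonneg E j : (j <= n_jobs I)%nat -> 0 <= early_load I E j.
Proof. intros. apply (early_load_mono E 0). lia. Qed.

(** The difference is the total length of the late jobs before the index, so it can only grow. *)
Lemma idle_gap_mono E i j : (i <= j <= n_jobs I)%nat ->
  Sstar I i - early_load I E i <= Sstar I j - early_load I E j.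
Proof.
  intros [Hij Hj]. induction Hij as [|j Hij IH]; [lia|].
  specialize (IH ltac:(lia)). rewrite Sstar_S, Cstar_eq, early_load_S.
  pose proof (proc_pos j ltac:(lia)). destruct (E j); lia.
Qed.

Lemma early_load_le_Sstar E j : (j <= n_jobs I)%nat ->
  early_load I E j <= Sstar I j.
Proof.
  intros Hj. pose proof (idle_gap_mono E 0 j ltac:(lia)) as H.
  unfold Sstar, early_load in *. simpl in H. lia.
Qed.

Lemma Sstar_mono i j : (i <= j <= n_jobs I)%nat -> Sstar I i <= Sstar I j.
Proof.
  intros H. apply zsum_mono; [lia|]. intros m Hm.
  pose proof (proc_pos m ltac:(lia)). lia.
Qed.

Lemma Cstar_le_Ptot j : (j < n_jobs I)%nat -> Cstar I j <= Ptot I.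
Proof. intros. apply (Sstar_mono (S j)). lia. Qed.

Lemma Sstar_nonneg j : (j <= n_jobs I)%nat -> 0 <= Sstar I j.
Proof. intros. apply (Sstar_mono 0). lia. Qed.

Lemma completion_nonneg E D j : (j < n_jobs I)%nat -> 0 <= completion I E D j.
Proof.
  intros Hj. pose proof (proc_pos j Hj). pose proof T1_T2.
  pose proof (early_load_nonneg E j ltac:(lia)).
  pose proof (early_load_le_Sstar E j ltac:(lia)).
  unfold completion. rewrite Cstar_eq. destruct (E j); lia.
Qed.

Lemma early_load_le_T1 E D j :
  (j <= n_jobs I)%nat ->
  (forall i, (i < n_jobs I)%nat -> admissible I E D i) ->
  early_load I E j <= T1 I.
Proof.
  intros Hj Hadm. pose proof T1_T2.
  induction j as [|j IH]; [unfold early_load; simpl; lia|].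
  specialize (IH ltac:(lia)). specialize (Hadm j ltac:(lia)).
  rewrite early_load_S. unfold admissible, completion in Hadm.
  destruct (E j); lia.
Qed.

(** Every admissible completion time is at most [T2 I + Ptot I]; this is what makes
    [infeasible_cost] large enough. *)
Lemma total_cost_le E D :
  (forall j, (j < n_jobs I)%nat -> admissible I E D j) ->
  total_cost I E D <= zsum (wgt I) (n_jobs I) * (T2 I + Ptot I).
Proof.
  intros Hadm. rewrite <- zsum_mul_r. apply zsum_le. intros j Hj.
  apply Z.mul_le_mono_nonneg_l; [pose proof (wgt_pos j Hj); lia|].
  specialize (Hadm j Hj). pose proof T1_T2.
  pose proof (Cstar_le_Ptot j Hj). pose proof (early_load_nonneg E j ltac:(lia)).
  pose proof (Sstar_nonneg j ltac:(lia)). pose proof (proc_pos j Hj).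
  rewrite !Cstar_eq in *.
  unfold admissible in Hadm. destruct (E j) eqn:Ej; [lia|].
  unfold completion. rewrite Ej, Cstar_eq. lia.
Qed.

Open Scope R_scope.

(** * From plans to schedules *)

Lemma admissible_schedule E D sigma :
  (0 <= D)%Z -> (D <= kbound I)%Z ->
  (forall j, (j < n_jobs I)%nat -> admissible I E D j) ->
  (forall j, (j < n_jobs I)%nat ->
     sigma j = IZR (completion I E D j - proc I j)) ->
  feasible I sigma /\
  objective I sigma <= Q2R (mu I) * IZR D + IZR (total_cost I E D).
Proof.
  intros HD Hk Hadm Hs. pose proof T1_T2 as HT.
  assert (HC : forall j, (j < n_jobs I)%nat -> Cj I sigma j = IZR (completion I E D j)).
  { intros j Hj. unfold Cj. rewrite Hs, minus_IZR by assumption. ring. }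
  assert (HDelta : Delta_max I sigma <= IZR D).
  { apply Rmaxn_le; [now apply IZR_le|]. intros j Hj. unfold Defs.Delta.
    rewrite HC, <- minus_IZR, <- abs_IZR by assumption. apply IZR_le.
    pose proof (Hadm j Hj) as Ha. pose proof (early_load_le_T1 E D j ltac:(lia) Hadm).
    pose proof (early_load_le_Sstar E j ltac:(lia)).
    unfold admissible, completion in *. rewrite !Cstar_eq in *. destruct (E j); lia. }
  split; [split; [split; [|split]|]|].
  - intros j Hj. rewrite Hs by assumption. apply IZR_le.
    pose proof (early_load_nonneg E j ltac:(lia)).
    pose proof (early_load_le_Sstar E j ltac:(lia)).
    unfold completion. rewrite Cstar_eq. destruct (E j); lia.
  - assert (H : forall i j, (i < j)%nat -> (j < n_jobs I)%nat ->
      Cj I sigma i <= sigma j \/ Cj I sigma j <= sigma i).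
    { intros i j Hij Hj. rewrite !HC, !Hs by lia.
      enough ((completion I E D i <= completion I E D j - proc I j)%Z \/
              (completion I E D j <= completion I E D i - proc I i)%Z)
        as [?|?] by (first [left; now apply IZR_le | right; now apply IZR_le]).
      pose proof (Hadm i ltac:(lia)) as Hi. pose proof (Hadm j Hj) as Hj'.
      pose proof (early_load_mono E (S i) j ltac:(lia)) as H1.
      pose proof (idle_gap_mono E (S i) j ltac:(lia)) as H2.
      pose proof (Sstar_mono (S i) j ltac:(lia)) as H3.
      pose proof (early_load_le_Sstar E i ltac:(lia)).
      pose proof (early_load_le_Sstar E j ltac:(lia)).
      rewrite early_load_S, Sstar_S in *.
      unfold admissible, completion in *. rewrite !Cstar_eq in *.
      destruct (E i), (E j); lia. }
    intros i j Hi Hj Hij. destruct (Nat.lt_total i j) as [?|[?|?]]; [auto|lia|].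
    destruct (H j i); auto.
  - intros j Hj. rewrite HC, Hs by assumption. specialize (Hadm j Hj).
    pose proof (early_load_le_Sstar E j ltac:(lia)).
    unfold admissible in Hadm. destruct (E j) eqn:Ej.
    + left. now apply IZR_le.
    + right. apply IZR_le. unfold completion. rewrite Ej, Cstar_eq. lia.
  - eapply Rle_trans; [exact HDelta|]. now apply IZR_le.
  - unfold objective. apply Rplus_le_compat.
    + apply Rmult_le_compat_l; [|assumption].
      rewrite <- RMicromega.Q2R_0. apply Qle_Rle. apply HI.
    + unfold total_cost, weighted. rewrite IZR_zsum. apply Req_le, Rsumn_ext.
      intros j Hj. now rewrite HC, mult_IZR.
Qed.

(** * Lower bound for real schedules *)

Definition real_completion (E : nat -> bool) (D : R) (j : nat) : R :=
  if E j then Rmax (IZR (early_load I E j + proc I j)) (IZR (Cstar I j) - D)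
  else IZR (T2 I - early_load I E j + Cstar I j).

Definition real_admissible (E : nat -> bool) (D : R) (j : nat) : Prop :=
  if E j then real_completion E D j <= IZR (T1 I)
  else IZR (T2 I - early_load I E j) <= D.

(** The two arguments of the maximum differ by [Sstar] minus the load, minus [D]. This is monotone
    by [idle_gap_mono], so they change order at most once. *)
Lemma threshold E (D : R) : exists m, forall j, (j < n_jobs I)%nat ->
  ((j < m)%nat -> IZR (Cstar I j) - D <= IZR (early_load I E j + proc I j)) /\
  ((m <= j)%nat -> IZR (early_load I E j + proc I j) <= IZR (Cstar I j) - D).
Proof.
  enough (H : forall k, (k <= n_jobs I)%nat -> exists m, forall j, (j < k)%nat ->
    ((j < m)%nat -> IZR (Cstar I j) - D <= IZR (early_load I E j + proc I j)) /\
    ((m <= j)%nat -> IZR (early_load I E j + proc I j) <= IZR (Cstar I j) - D)).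
  { now apply H. }
  induction k as [|k IH]; intros Hk; [exists 0%nat; lia|].
  destruct (Rle_dec (IZR (Cstar I k) - D) (IZR (early_load I E k + proc I k)))
    as [Hle|Hgt].
  - exists (S k). intros j Hj. split; [intros _|lia].
    pose proof (idle_gap_mono E j k ltac:(lia)) as H. apply IZR_le in H.
    rewrite Cstar_eq, !plus_IZR in *. rewrite !minus_IZR in H. lra.
  - destruct (IH ltac:(lia)) as [m Hm]. exists (Nat.min m k).
    intros j Hj. destruct (Nat.eq_dec j k) as [->|].
    + split; [lia|]. intros _. lra.
    + destruct (Hm j ltac:(lia)). split; intros; [apply H|apply H0]; lia.
Qed.

Definition early_in (tau : nat -> R) (j : nat) : bool :=
  if Rle_dec (Cj I tau j) (IZR (T1 I)) then true else false.

Lemma real_admissible_of_feasible tau j :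
  feasible I tau -> (j < n_jobs I)%nat ->
  real_admissible (early_in tau) (Delta_max I tau) j.
Proof.
  intros [(Hpos & Hdis & Hint) Hk] Hj. set (E := early_in tau).
  assert (HDel : forall i, (i < n_jobs I)%nat ->
    Rabs (Cj I tau i - IZR (Cstar I i)) <= Delta_max I tau).
  { intros i Hi. now apply (Rmaxn_ge (Defs.Delta I tau)). }
  assert (Hlate : forall i, (i < n_jobs I)%nat -> E i = false ->
    IZR (T2 I - Sstar I i) <= Delta_max I tau).
  { intros i Hi Ei. unfold E, early_in in Ei. destruct (Hint i Hi) as [H|H].
    - destruct (Rle_dec _ _); [discriminate|contradiction].
    - eapply Rle_trans; [|apply (HDel i Hi)].
      eapply Rle_trans; [|apply Rle_abs].
      unfold Cj. rewrite Cstar_eq, minus_IZR, plus_IZR. lra. }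
  unfold real_admissible. destruct (E j) eqn:Ej.
  - unfold real_completion. rewrite Ej. apply Rmax_lub.
    + replace (early_load I E j + proc I j)%Z with (early_load I E (S j))
        by (now rewrite early_load_S, Ej).
      unfold early_load. rewrite IZR_zsum.
      rewrite (Rsumn_ext _ (fun i => if E i then IZR (proc I i) else 0))
        by (intros i _; now destruct (E i)).
      eapply Rle_trans; [apply packing with (s := tau) (a := 0) (b := IZR (T1 I))|lra].
      * apply IZR_le, T1_T2.
      * intros i Hi Ei. split; [apply Hpos; lia|]. unfold E, early_in in Ei.
        destruct (Rle_dec _ _); [assumption|discriminate].
      * intros i i' Hi Hi' _ _. apply Hdis; lia.
    + specialize (HDel j Hj). unfold E, early_in in Ej.
      destruct (Rle_dec _ _) as [H|]; [|discriminate].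
      rewrite Rabs_minus_sym in HDel.
      pose proof (Rle_abs (IZR (Cstar I j) - Cj I tau j)). lra.
  (* Up to the first late job the load is [Sstar], so the delay of that job gives the bound;
     afterwards a larger load only weakens it. *)
  - assert (H : forall i, (i <= n_jobs I)%nat -> early_load I E i = Sstar I i \/
        IZR (T2 I - early_load I E i) <= Delta_max I tau).
    { induction i as [|i IH]; intros Hi; [now left|].
      rewrite early_load_S, Sstar_S, Cstar_eq.
      destruct (IH ltac:(lia)) as [H|H].
      - destruct (E i) eqn:Ei; [left; lia|right].
        rewrite H, Z.add_0_r. apply Hlate; [lia|assumption].
      - right. eapply Rle_trans; [|exact H]. apply IZR_le.
        pose proof (proc_pos i ltac:(lia)). destruct (E i); lia. }
    destruct (H j ltac:(lia)) as [->|]; auto.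
Qed.

Lemma real_cost_lower_bound tau :
  feasible I tau ->
  Rsumn (fun j => IZR (wgt I j)
    * real_completion (early_in tau) (Delta_max I tau) j) (n_jobs I)
  <= Rsumn (fun j => IZR (wgt I j) * Cj I tau j) (n_jobs I).
Proof.
  intros [(Hpos & Hdis & Hint) Hk]. set (E := early_in tau).
  set (D := Delta_max I tau). set (n := n_jobs I).
  destruct (threshold E D) as [m Hm].
  (* [A] is bounded by Smith's rule from time 0, [L] by Smith's rule from [T2], and [B] by the
     deviation alone. *)
  set (A := fun j => E j && Nat.ltb j m).
  set (L := fun j => negb (E j)).
  set (B := fun j => E j && negb (Nat.ltb j m)).
  assert (Hsplit : forall f : nat -> R, Rsumn f n
     = Rsumn (fun j => if A j then f j else 0) n
       + Rsumn (fun j => if L j then f j else 0) n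
       + Rsumn (fun j => if B j then f j else 0) n).
  { intros f. rewrite <- !Rsumn_plus. apply Rsumn_ext. intros j _.
    unfold A, B, L. destruct (E j), (Nat.ltb j m); simpl; lra. }
  assert (Hsmith : forall A' a, (forall j, (j < n)%nat -> A' j = true -> a <= tau j) ->
    Rsumn (fun j => if A' j then IZR (wgt I j)
       * (a + IZR (early_load I A' j) + IZR (proc I j)) else 0) n
    <= Rsumn (fun j => if A' j then IZR (wgt I j) * Cj I tau j else 0) n).
  { intros A' a Ha.
    eapply Rle_trans; [|apply (smith_rule (fun j => IZR (proc I j))
      (fun j => IZR (wgt I j)) tau n A' a)].
    - apply Req_le, Rsumn_ext. intros j _. destruct (A' j); [|reflexivity].
      unfold early_load. rewrite IZR_zsum. do 3 f_equal.
      apply Rsumn_ext. intros i _. now destruct (A' i).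
    - intros j Hj. split; apply IZR_le.
      + pose proof (proc_pos j Hj); lia.
      + pose proof (wgt_pos j Hj); lia.
    - intros i j Hij Hj. rewrite <- !mult_IZR. apply IZR_le. now apply wspt_ratio.
    - assumption.
    - intros i j Hi Hj _ _. now apply Hdis. }
  rewrite (Hsplit (fun j => _ * real_completion E D j)),
          (Hsplit (fun j => _ * Cj I tau j)).
  repeat apply Rplus_le_compat.
  - eapply Rle_trans; [|apply (Hsmith A 0)].
    + apply Rsumn_le. intros j Hj. destruct (A j) eqn:Aj; [|lra].
      apply andb_prop in Aj as [Ej Hjm]. apply Nat.ltb_lt in Hjm.
      unfold real_completion. rewrite Ej. destruct (Hm j Hj) as [Hx _].
      rewrite Rmax_left by auto. rewrite plus_IZR.
      (* The threshold is an index, so every early job before a member of [A] is itself in [A], and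
         the loads agree. *)
      replace (early_load I A j) with (early_load I E j); [apply Req_le; ring|].
      apply zsum_ext. intros i Hi. unfold A.
      replace (Nat.ltb i m) with true by (symmetry; apply Nat.ltb_lt; lia).
      now rewrite andb_true_r.
    + intros j Hj _. now apply Hpos.
  - eapply Rle_trans; [|apply (Hsmith L (IZR (T2 I)))].
    + apply Rsumn_le. intros j Hj. destruct (L j) eqn:Lj; [|lra].
      unfold L in Lj. apply negb_true_iff in Lj.
      unfold real_completion. rewrite Lj.
      (* The early load cancels: a late job ends at [T2] plus the late load before it plus its own
         length. *)
      replace (Cstar I j) with (early_load I E j + early_load I L j + proc I j)%Z.
      * rewrite !plus_IZR, minus_IZR. apply Req_le; ring.
      * rewrite Cstar_eq. f_equal. unfold L, Sstar, early_load.
        clear. induction j; simpl; [reflexivity|]. destruct (E j); simpl in *; lia.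
    + intros j Hj Lj. unfold L, E, early_in in Lj.
      destruct (Hint j Hj); [|assumption].
      destruct (Rle_dec _ _); [discriminate|contradiction].
  - apply Rsumn_le. intros j Hj. destruct (B j) eqn:Bj; [|lra].
    apply andb_prop in Bj as [Ej Hjm]. apply negb_true_iff, Nat.ltb_ge in Hjm.
    apply Rmult_le_compat_l; [apply IZR_le; pose proof (wgt_pos j Hj); lia|].
    unfold real_completion. rewrite Ej. destruct (Hm j Hj) as [_ Hx].
    rewrite Rmax_right by auto.
    assert (H : (Defs.Delta I tau j <= D)) by exact (Rmaxn_ge _ n j Hj).
    unfold Defs.Delta in H. rewrite Rabs_minus_sym in H.
    pose proof (Rle_abs (IZR (Cstar I j) - Cj I tau j)). lra.
Qed.

(** * Rounding the deviation bound *)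

(** The two arguments of the maximum cross at an integer [D], so no kink lies strictly between [d]
    and [d + 1]. *)
Lemma real_completion_affine E (d : Z) (theta : R) j :
  0 <= theta <= 1 ->
  real_completion E (IZR d + theta) j
  = (1 - theta) * IZR (completion I E d j) + theta * IZR (completion I E (d + 1) j).
Proof.
  intros Ht. unfold real_completion, completion. destruct (E j); [|ring].
  destruct (Z_lt_le_dec (early_load I E j + proc I j) (Cstar I j - d)) as [H|H].
  - rewrite !Z.max_r by lia.
    assert (H' : (early_load I E j + proc I j <= Cstar I j - (d + 1))%Z) by lia.
    apply IZR_le in H'. rewrite !minus_IZR, !plus_IZR in *.
    rewrite Rmax_right; lra.
  - rewrite !Z.max_l by lia. apply IZR_le in H. rewrite !minus_IZR, !plus_IZR in *.
    rewrite Rmax_left; lra.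
Qed.

Definition plan_cost (E : nat -> bool) (D : Z) : R :=
  Q2R (mu I) * IZR D + IZR (total_cost I E D).

(* Between consecutive integers the cost is affine in the deviation bound. *)
Lemma integral_relaxation E (D : R) :
  0 <= D <= IZR (kbound I) ->
  (forall j, (j < n_jobs I)%nat -> real_admissible E D j) ->
  exists d : Z, (0 <= d <= kbound I)%Z /\
    (forall j, (j < n_jobs I)%nat -> admissible I E d j) /\
    plan_cost E d <= Q2R (mu I) * D
      + Rsumn (fun j => IZR (wgt I j) * real_completion E D j) (n_jobs I).
Proof.
  intros [HD0 HDk] Hadm.
  (* [up D] is the integer in (D, D + 1], so [d] is the floor of [D]. *)
  set (d := (up D - 1)%Z). destruct (archimed D) as [Hu1 Hu2].
  assert (Hd : IZR d <= D < IZR d + 1) by (unfold d; rewrite minus_IZR; lra).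
  assert (Hfloor : forall z, IZR z <= D -> (z <= d)%Z).
  { intros z Hz. apply Z.lt_succ_r, lt_IZR. unfold Z.succ. rewrite plus_IZR. lra. }
  (* Admissibility compares [D] with integers only, so it survives rounding down, and it persists
     for larger bounds. *)
  assert (Hadm_ge : forall e, (d <= e)%Z ->
    forall j, (j < n_jobs I)%nat -> admissible I E e j).
  { intros e He j Hj. specialize (Hadm j Hj).
    unfold real_admissible, real_completion in Hadm.
    unfold admissible, completion. destruct (E j).
    - pose proof (Rmax_l (IZR (early_load I E j + proc I j)) (IZR (Cstar I j) - D)).
      pose proof (Rmax_r (IZR (early_load I E j + proc I j)) (IZR (Cstar I j) - D)).
      assert (early_load I E j + proc I j <= T1 I)%Z by (apply le_IZR; lra).
      assert (Cstar I j - T1 I <= d)%Z by (apply Hfloor; rewrite minus_IZR; lra).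
      lia.
    - specialize (Hfloor _ Hadm). lia. }
  set (theta := D - IZR d).
  assert (Hcost : Q2R (mu I) * D
      + Rsumn (fun j => IZR (wgt I j) * real_completion E D j) (n_jobs I)
    = (1 - theta) * plan_cost E d + theta * plan_cost E (d + 1)).
  { unfold plan_cost, total_cost, weighted. rewrite !IZR_zsum.
    rewrite (Rsumn_ext _ (fun j => (1 - theta) * IZR (wgt I j * completion I E d j)
       + theta * IZR (wgt I j * completion I E (d + 1) j))).
    - rewrite Rsumn_plus, !Rsumn_mul_l, plus_IZR. unfold theta. ring.
    - intros j _. replace D with (IZR d + theta) by (unfold theta; ring).
      rewrite real_completion_affine by (unfold theta; lra).
      rewrite !mult_IZR. ring. }
  rewrite Hcost. clear Hcost.
  assert (Hd0 : (0 <= d)%Z) by (apply Hfloor; lra).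
  assert (Hdk : (d <= kbound I)%Z) by (apply le_IZR; lra).
  destruct (Rle_dec (plan_cost E d) (plan_cost E (d + 1))) as [Hle|Hgt].
  - exists d. repeat split; auto.
    + apply Hadm_ge; lia.
    + assert (0 <= theta * (plan_cost E (d + 1) - plan_cost E d))
        by (apply Rmult_le_pos; unfold theta; lra). lra.
  (* If [d] is already the largest allowed bound, then [D] equals [d] and the right endpoint has
     weight 0. *)
  - destruct (Z.eq_dec d (kbound I)) as [Heq|Hne].
    + exists d. repeat split; auto.
      * apply Hadm_ge; lia.
      * assert (theta = 0) by (unfold theta; rewrite Heq in *; lra).
        replace theta with 0. lra.
    + exists (d + 1)%Z. repeat split; try lia.
      * apply Hadm_ge; lia.
      * assert (0 <= (1 - theta) * (plan_cost E d - plan_cost E (d + 1)))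
          by (apply Rmult_le_pos; unfold theta; lra). lra.
Qed.

Lemma integral_plan tau :
  feasible I tau ->
  exists E D, (0 <= D <= Z.min (kbound I) (T2 I + Ptot I))%Z /\
    (forall j, (j < n_jobs I)%nat -> admissible I E D j) /\
    plan_cost E D <= objective I tau.
Proof.
  intros Htau.
  destruct (integral_relaxation (early_in tau) (Delta_max I tau))
    as (d & Hd & Hadm & Hcost).
  - split; [apply Rmaxn_nonneg|apply Htau].
  - intros. now apply real_admissible_of_feasible.
  - assert (Hobj : plan_cost (early_in tau) d <= objective I tau).
    { eapply Rle_trans; [exact Hcost|]. apply Rplus_le_compat_l.
      now apply real_cost_lower_bound. }
    clear Hcost. set (E := early_in tau) in *. exists E.
    pose proof T1_T2. assert (0 <= Ptot I)%Z by (apply Sstar_nonneg; lia).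
    destruct (Z_le_gt_dec d (T2 I + Ptot I)) as [Hle|Hgt].
    { exists d. repeat split; auto; lia. }
    (* At this bound every release time is negative and every delay is allowed, so lowering [d] to
       it keeps all completion times and does not raise the [mu] term. *)
    exists (T2 I + Ptot I)%Z.
    assert (Hcmp : forall j, (j < n_jobs I)%nat ->
      completion I E (T2 I + Ptot I) j = completion I E d j).
    { intros j Hj. pose proof (Cstar_le_Ptot j Hj). pose proof (proc_pos j Hj).
      pose proof (early_load_nonneg E j ltac:(lia)).
      unfold completion. destruct (E j); lia. }
    repeat split; try lia.
    + intros j Hj. specialize (Hadm j Hj). unfold admissible in *.
      rewrite Hcmp by assumption. destruct (E j); [assumption|].
      pose proof (early_load_nonneg E j ltac:(lia)). lia.
    + eapply Rle_trans; [|exact Hobj]. unfold plan_cost. apply Rplus_le_compat.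
      * apply Rmult_le_compat_l; [|apply IZR_le; lia].
        rewrite <- RMicromega.Q2R_0. apply Qle_Rle. apply HI.
      * apply IZR_le, Z.eq_le_incl, zsum_ext. intros j Hj. unfold weighted.
        now rewrite Hcmp.
Qed.

Close Scope R_scope.

End Valid.

(** * Dynamic program *)

(* A table entry pairs the least cost of the remaining jobs, given that the
   early jobs so far have total length x, with the start time that achieves it
   for the next job.  B is a cost that stands for infeasibility. *)
Definition dp_entry (I : instance) (B D : Z) (j : nat) (f : Z -> Z) (x : Z) : Z * Z :=
  let late := T2 I - x + Cstar I j in
  let early := Z.max (x + proc I j) (Cstar I j - D) in
  let best :=
    if D <? T2 I - x then (B, 0)
    else let u := f x + wgt I j * late in
         if u <? B then (u, late - proc I j) else (B, 0) in
  if T1 I <? early then best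
  else let u := f (x + proc I j) + wgt I j * early in
       if u <? fst best then (u, early - proc I j) else best.

(** Row [m] concerns the last [m] jobs: the rows are filled from the last job on, and the choices
    are then read off in index order. *)
Fixpoint dp (I : instance) (B D : Z) (m : nat) (x : Z) : Z * Z :=
  match m with
  | O => (0, 0)
  | S m' => dp_entry I B D (n_jobs I - S m') (fun y => fst (dp I B D m' y)) x
  end.

(** The choice itself is not stored: early jobs start before [T2] and late ones at or after it, so
    the start time reveals it. Infeasible entries carry the dummy start 0; [dp_trace] excludes them
    by requiring a cost below [B]. *)
Fixpoint trace_load (I : instance) (B D : Z) (j : nat) : Z :=
  match j with
  | O => 0
  | S j' =>
      let x := trace_load I B D j' in
      if snd (dp I B D (n_jobs I - j') x) <? T2 I then x + proc I j' else x
  end.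

Definition trace_start (I : instance) (B D : Z) (j : nat) : Z :=
  snd (dp I B D (n_jobs I - j) (trace_load I B D j)).

Definition trace_early (I : instance) (B D : Z) (j : nat) : bool :=
  trace_start I B D j <? T2 I.

Lemma trace_load_eq I B D j :
  trace_load I B D j = early_load I (trace_early I B D) j.
Proof.
  induction j as [|j IH]; [reflexivity|].
  rewrite early_load_S, <- IH. simpl. unfold trace_early, trace_start.
  destruct (_ <? _); lia.
Qed.

Section Recurrence.

Context (I : instance) (HI : valid_instance I) (B D : Z).

Ltac case_tests :=
  repeat match goal with
  | |- context [?a <? ?b] => destruct (Z.ltb_spec a b); cbn [fst snd] in *
  | H : context [_ <? _] |- _ => revert H
  end; intros.

Lemma dp_entry_le_late j f x :
  T2 I - x <= D ->
  fst (dp_entry I B D j f x) <= f x + wgt I j * (T2 I - x + Cstar I j).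
Proof. unfold dp_entry; cbv zeta; intros; case_tests; lia. Qed.

Lemma dp_entry_le_early j f x :
  Z.max (x + proc I j) (Cstar I j - D) <= T1 I ->
  fst (dp_entry I B D j f x)
  <= f (x + proc I j) + wgt I j * Z.max (x + proc I j) (Cstar I j - D).
Proof. unfold dp_entry; cbv zeta; intros; case_tests; lia. Qed.

Lemma dp_entry_cases j f x :
  fst (dp_entry I B D j f x) < B ->
  let early := Z.max (x + proc I j) (Cstar I j - D) in
  let late := T2 I - x + Cstar I j in
  early <= T1 I /\
    dp_entry I B D j f x = (f (x + proc I j) + wgt I j * early, early - proc I j) \/
  T2 I - x <= D /\
    dp_entry I B D j f x = (f x + wgt I j * late, late - proc I j).
Proof. unfold dp_entry. cbv zeta. case_tests; auto; lia. Qed.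

Lemma dp_le E m :
  (m <= n_jobs I)%nat ->
  (forall j, (n_jobs I - m <= j < n_jobs I)%nat -> admissible I E D j) ->
  fst (dp I B D m (early_load I E (n_jobs I - m)))
  <= total_cost I E D - zsum (weighted I E D) (n_jobs I - m).
Proof.
  induction m as [|m IH]; intros Hm Hadm.
  - rewrite Nat.sub_0_r. unfold total_cost. simpl. lia.
  - specialize (IH ltac:(lia) ltac:(intros; apply Hadm; lia)).
    remember (n_jobs I - S m)%nat as j eqn:Hj.
    replace (n_jobs I - m)%nat with (S j) in IH by lia.
    specialize (Hadm j ltac:(lia)). rewrite early_load_S in IH. simpl zsum in IH.
    unfold weighted at 2 in IH. unfold admissible, completion in *.
    cbn [dp]. rewrite <- Hj. destruct (E j).
    + eapply Z.le_trans; [now apply dp_entry_le_early|]. cbv beta. lia.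
    + rewrite Z.add_0_r in IH.
      eapply Z.le_trans; [now apply dp_entry_le_late|]. cbv beta. lia.
Qed.

(** Costs are nonnegative, so a value below [B] forces the next entry on the trace below [B] as
    well. No entry on it is a dummy, and the value is an exact cost. *)
Lemma dp_trace m :
  (m <= n_jobs I)%nat ->
  let E := trace_early I B D in
  let v := fst (dp I B D m (early_load I E (n_jobs I - m))) in
  v < B ->
  v = total_cost I E D - zsum (weighted I E D) (n_jobs I - m) /\
  forall j, (n_jobs I - m <= j < n_jobs I)%nat ->
    admissible I E D j /\ trace_start I B D j = completion I E D j - proc I j.
Proof.
  intros Hm E. induction m as [|m IH]; intros v Hv.
  - split; [|lia]. unfold v. rewrite Nat.sub_0_r. unfold total_cost. simpl. lia.
  - specialize (IH ltac:(lia)). cbv zeta in IH.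
    remember (n_jobs I - S m)%nat as j eqn:Hj.
    replace (n_jobs I - m)%nat with (S j) in IH by lia.
    set (x := early_load I E j) in *. set (f := fun y => fst (dp I B D m y)).
    assert (Hst : trace_start I B D j = snd (dp_entry I B D j f x)).
    { unfold trace_start. rewrite trace_load_eq. fold E x.
      replace (n_jobs I - j)%nat with (S m) by lia. cbn [dp]. now rewrite <- Hj. }
    assert (Hval : v = fst (dp_entry I B D j f x))
      by (unfold v; cbn [dp]; now rewrite <- Hj).
    rewrite Hval in *. clear v Hval.
    pose proof (eq_refl : E j = (trace_start I B D j <? T2 I)) as HE.
    pose proof (early_load_le_Sstar I HI E j ltac:(lia)) as Hx. fold x in Hx.
    pose proof (early_load_nonneg I HI E j ltac:(lia)) as Hx0. fold x in Hx0.
    pose proof (T1_T2 I HI) as HT. pose proof (proc_pos I HI j ltac:(lia)) as Hp.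
    pose proof (completion_nonneg I HI E D j ltac:(lia)) as HC.
    pose proof (wgt_pos I HI j ltac:(lia)) as Hw.
    assert (Hwc : 0 <= weighted I E D j) by (apply Z.mul_nonneg_nonneg; lia).
    rewrite early_load_S in IH. fold x in IH. simpl zsum in IH.
    assert (Hj' : forall i, (j <= i < n_jobs I)%nat -> i = j \/ (S j <= i < n_jobs I)%nat)
      by lia.
    assert (Hstep : admissible I E D j /\
      trace_start I B D j = completion I E D j - proc I j /\
      fst (dp_entry I B D j f x)
      = f (x + (if E j then proc I j else 0)) + weighted I E D j).
    { unfold admissible, weighted, completion. fold x.
      (* An early start is at most [T1 I - proc I j], below [T2 I], and a late start is at least
         [T2 I], so the stored start determines [E j]. *)
      destruct (dp_entry_cases j f x Hv) as [[Hc Heq]|[Hc Heq]];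
        rewrite Hst, Heq in *; cbn [fst snd] in *.
      - replace (E j) with true by (rewrite HE; symmetry; apply Z.ltb_lt; lia).
        auto.
      - rewrite Cstar_eq in *.
        replace (E j) with false by (rewrite HE; symmetry; apply Z.ltb_ge; lia).
        rewrite Z.add_0_r. auto. }
    destruct Hstep as (Hadm & Hstart & Hcost). unfold f in Hcost at 2.
    destruct IH as [IHc IHs]; [lia|]. split; [lia|].
    intros i Hi. destruct (Hj' i Hi) as [->|]; auto.
Qed.

End Recurrence.

(** * Minimization over the deviation bound *)

(* Scaled by the denominator of mu, it exceeds every scaled feasible objective. *)
Definition infeasible_cost (I : instance) : Z :=
  (zsum (wgt I) (n_jobs I) + Qnum (mu I)) * (T2 I + Ptot I) + 1.

(** Multiplying by the denominator of [mu] keeps every comparison of the search in the integers. *)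
Definition scaled_objective (I : instance) (D : Z) : Z :=
  Z.pos (Qden (mu I)) * fst (dp I (infeasible_cost I) D (n_jobs I) 0)
  + Qnum (mu I) * D.

Definition deviation_cap (I : instance) : Z := Z.min (kbound I) (T2 I + Ptot I).

Lemma mu_num_nonneg I : valid_instance I -> 0 <= Qnum (mu I).
Proof.
  intros HI. assert (H : (0 <= mu I)%Q) by apply HI.
  unfold Qle in H. simpl in H. lia.
Qed.

Lemma scaled_plan_cost I E D :
  IZR (Z.pos (Qden (mu I)) * total_cost I E D + Qnum (mu I) * D)
  = (IZR (Z.pos (Qden (mu I))) * plan_cost I E D)%R.
Proof.
  unfold plan_cost, Q2R. rewrite plus_IZR, !mult_IZR.
  assert (0 < IZR (Z.pos (Qden (mu I))))%R by (apply IZR_lt; lia).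
  field. lra.
Qed.

(** [best] is either attained at [D] or still the initial value of the search, which feasibility
    rules out. The bound on the loads keeps the tracing loop inside the table. *)
Lemma best_trace_optimal I (HI : valid_instance I) best D :
  (exists tau, feasible I tau) ->
  0 <= D <= deviation_cap I ->
  (forall D', 0 <= D' <= deviation_cap I -> best <= scaled_objective I D') ->
  best = scaled_objective I D \/ Z.pos (Qden (mu I)) * infeasible_cost I <= best ->
  (forall j, (j <= n_jobs I)%nat ->
     0 <= trace_load I (infeasible_cost I) D j <= T1 I) /\
  forall sigma,
    (forall j, (j < n_jobs I)%nat ->
       sigma j = IZR (trace_start I (infeasible_cost I) D j)) ->
    optimal I sigma.
Proof.
  intros [tau0 Htau0] HD Hmin Hbest.
  set (q := Z.pos (Qden (mu I))) in *. set (B := infeasible_cost I) in *.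
  pose proof (mu_num_nonneg I HI) as Hnum. pose proof (T1_T2 I HI) as HT.
  assert (HP : 0 <= Ptot I) by (apply (Sstar_nonneg I HI); lia).
  assert (Hq : 0 < q) by (unfold q; lia).
  assert (Hplan : forall tau, feasible I tau -> exists D',
    0 <= D' <= deviation_cap I /\ scaled_objective I D' < q * B /\
    (IZR (scaled_objective I D') <= IZR q * objective I tau)%R).
  { intros tau Htau.
    destruct (integral_plan I HI tau Htau) as (E & D' & HD' & Hadm & Hcost).
    exists D'. split; [exact HD'|].
    pose proof (dp_le I B D' E (n_jobs I) ltac:(lia) ltac:(intros; apply Hadm; lia))
      as Hle.
    rewrite Nat.sub_diag in Hle. unfold early_load in Hle. cbn [zsum] in Hle.
    rewrite Z.sub_0_r in Hle.
    pose proof (total_cost_le I HI E D' Hadm) as Htot.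
    assert (Hs : scaled_objective I D' <= q * total_cost I E D' + Qnum (mu I) * D').
    { unfold scaled_objective. fold q B. nia. }
    split.
    - eapply Z.le_lt_trans; [exact Hs|]. unfold B, infeasible_cost.
      assert (Qnum (mu I) * D' <= Qnum (mu I) * (T2 I + Ptot I)).
      { apply Z.mul_le_mono_nonneg_l; [assumption|]. unfold deviation_cap in HD'. lia. }
      nia.
    - eapply Rle_trans; [apply IZR_le, Hs|]. unfold q. rewrite scaled_plan_cost.
      apply Rmult_le_compat_l; [apply IZR_le; lia|assumption]. }
  (* The feasible schedule [tau0] yields a bound whose objective is below the initial value, so
     [best] is attained. *)
  destruct (Hplan tau0 Htau0) as (D0 & HD0 & Hlt0 & _).
  assert (Hlt : best = scaled_objective I D /\ best < q * B).
  { specialize (Hmin D0 HD0). lia. }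
  destruct Hlt as [-> Hlt]. clear Hbest.
  assert (Hv : fst (dp I B D (n_jobs I) 0) < B).
  { unfold scaled_objective in Hlt. fold q B in Hlt. nia. }
  destruct (dp_trace I HI B D (n_jobs I) ltac:(lia)) as [Hval Htrace].
  { rewrite Nat.sub_diag. exact Hv. }
  rewrite Nat.sub_diag in Hval, Htrace. unfold early_load in Hval.
  cbn [zsum] in Hval. rewrite Z.sub_0_r in Hval.
  set (E := trace_early I B D) in *.
  assert (Hadm : forall j, (j < n_jobs I)%nat -> admissible I E D j)
    by (intros; apply Htrace; lia).
  split.
  { intros j Hj. rewrite trace_load_eq. fold E. split.
    - now apply early_load_nonneg.
    - now apply early_load_le_T1 with D. }
  intros sigma Hsigma.
  destruct (admissible_schedule I HI E D sigma) as [Hfeas Hobj].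
  - lia.
  - unfold deviation_cap in HD. lia.
  - exact Hadm.
  - intros j Hj. rewrite Hsigma by assumption. f_equal. apply Htrace; lia.
  - split; [exact Hfeas|]. intros tau Htau.
    destruct (Hplan tau Htau) as (D' & HD' & _ & Hle).
    eapply Rle_trans; [exact Hobj|].
    apply Rmult_le_reg_l with (IZR q); [now apply IZR_lt|].
    fold (plan_cost I E D). unfold q at 1. rewrite <- scaled_plan_cost. fold q.
    rewrite <- Hval. eapply Rle_trans; [|exact Hle]. apply IZR_le. now apply Hmin.
Qed.

(** * RAM implementation *)

Notation r_zero := 0%nat (only parsing).
Notation r_one := 1%nat (only parsing).
Notation r_n := 2%nat (only parsing).
Notation r_T1 := 3%nat (only parsing).
Notation r_T2 := 4%nat (only parsing).
Notation r_cap := 5%nat (only parsing).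
Notation r_num := 6%nat (only parsing).
Notation r_den := 7%nat (only parsing).
Notation r_P := 8%nat (only parsing).
Notation r_B := 9%nat (only parsing).
Notation r_width := 10%nat (only parsing).
Notation r_D := 11%nat (only parsing).
Notation r_best := 12%nat (only parsing).
Notation r_bestD := 13%nat (only parsing).
Notation r_i := 14%nat (only parsing).
Notation r_x := 15%nat (only parsing).
Notation r_C := 16%nat (only parsing).
Notation r_p := 17%nat (only parsing).
Notation r_w := 18%nat (only parsing).
Notation r_cost := 19%nat (only parsing).
Notation r_a := 20%nat (only parsing).
Notation r_b := 21%nat (only parsing).
Notation r_start := 22%nat (only parsing).
Notation r_minus := 23%nat (only parsing).
Notation r_base := 24%nat (only parsing).
Notation r_t := 25%nat (only parsing).
Notation r_u := 26%nat (only parsing).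
Notation r_v := 27%nat (only parsing).

Definition keep_cheaper : cmd :=
  If r_u r_cost
    (Do [Iadd r_cost r_u r_zero; Isub r_start r_t r_p])
    (Do []).

Definition try_late : cmd :=
  If r_D r_t (Do [])
    (Seq (Do [Iload r_u r_b; Iadd r_t r_t r_C; Imul r_v r_w r_t; Iadd r_u r_u r_v])
         keep_cheaper).

Definition try_early : cmd :=
  If r_T1 r_t (Do [])
    (Seq (Do [Isub r_u r_b r_p; Iload r_u r_u; Imul r_v r_w r_t; Iadd r_u r_u r_v])
         keep_cheaper).

(** [r_b] is the address [-1 - cell] of a cost: a larger load means subtracting from it, and the
    next row lies [r_width] below. *)
Definition entry_cmd : cmd :=
  Seq (Do [Imul r_a r_i r_width; Iadd r_a r_a r_x; Isub r_b r_minus r_a;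
           Iadd r_cost r_B r_zero; Iconst r_start 0; Isub r_t r_T2 r_x])
  (Seq try_late
  (Seq (Do [Iadd r_u r_x r_p; Isub r_t r_C r_D])
  (Seq (If r_t r_u (Do [Iadd r_t r_u r_zero]) (Do []))
  (Seq try_early
       (Do [Isub r_b r_b r_width; Istore r_b r_cost;
            Iadd r_a r_a r_width; Iadd r_a r_a r_base; Istore r_a r_start;
            Iadd r_x r_x r_one]))))).

(** Job [n - 1 - i] has its processing time at address [6 + 2 * (n - 1 - i)], that is
    [2 * (n - i) + 4]. Subtracting it from [r_C] leaves the original completion time of the
    preceding job. *)
Definition row_cmd : cmd :=
  Seq (Do [Isub r_a r_n r_i; Iadd r_a r_a r_a; Iconst r_b 4; Iadd r_a r_a r_b;
           Iload r_p r_a; Iadd r_a r_a r_one; Iload r_w r_a; Iconst r_x 0])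
  (Seq (While r_x r_width entry_cmd)
       (Do [Isub r_C r_C r_p; Iadd r_i r_i r_one])).

Definition dp_cmd : cmd :=
  Seq (Do [Iconst r_i 0; Iadd r_C r_P r_zero]) (While r_i r_n row_cmd).

Definition search_cmd : cmd :=
  Seq dp_cmd
  (Seq (Do [Imul r_a r_n r_width; Isub r_a r_minus r_a; Iload r_a r_a;
            Imul r_a r_den r_a; Imul r_b r_num r_D; Iadd r_a r_a r_b])
  (Seq (If r_a r_best (Do [Iadd r_best r_a r_zero; Iadd r_bestD r_D r_zero]) (Do []))
       (Do [Iadd r_D r_D r_one]))).

(* The schedule is written over the input: cell j is overwritten only after the
   processing time of job j, at address 6 + 2j > j, has been read. *)
Definition trace_cmd : cmd :=
  Seq (Do [Iadd r_a r_i r_i; Iconst r_b 6; Iadd r_a r_a r_b; Iload r_p r_a;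
           Iadd r_b r_base r_C; Iadd r_b r_b r_x; Iload r_start r_b;
           Istore r_i r_start; Isub r_C r_C r_width; Iadd r_i r_i r_one])
      (If r_start r_T2 (Do [Iadd r_x r_x r_p]) (Do [])).

Definition sum_cmd : cmd :=
  Do [Iload r_b r_a; Iadd r_P r_P r_b; Iadd r_a r_a r_one;
      Iload r_b r_a; Iadd r_B r_B r_b; Iadd r_a r_a r_one].

(** [r_zero], [r_P], [r_B], [r_D] and [r_bestD] rely on registers being initially 0. [r_cap] ends
    one above the cap because [While] tests strictly. *)
Definition setup_cmd : cmd :=
  Seq (Do [Iconst r_one 1; Iload r_n r_zero; Iload r_T1 r_one;
           Iconst r_a 2; Iload r_T2 r_a; Iconst r_a 3; Iload r_cap r_a;
           Iconst r_a 4; Iload r_num r_a; Iconst r_a 5; Iload r_den r_a;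
           Iconst r_a 6; Iadd r_base r_n r_n; Iadd r_base r_base r_a;
           Iconst r_minus (-1); Iadd r_width r_T1 r_one])
  (Seq (While r_a r_base sum_cmd)
  (Seq (Do [Iadd r_b r_T2 r_P; Iadd r_B r_B r_num; Imul r_B r_B r_b;
            Iadd r_B r_B r_one; Imul r_best r_den r_B])
  (Seq (If r_cap r_b (Do []) (Do [Iadd r_cap r_b r_zero]))
       (Do [Iadd r_cap r_cap r_one])))).

Definition solver : cmd :=
  Seq setup_cmd
  (Seq (While r_D r_cap search_cmd)
  (Seq (Do [Iadd r_D r_bestD r_zero])
  (Seq dp_cmd
  (Seq (Do [Iconst r_i 0; Iconst r_x 0; Imul r_C r_n r_width])
       (While r_i r_n trace_cmd))))).

Ltac read_regs :=
  cbn [fold_left effect fst snd];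
  cbv beta iota delta [upd_reg Nat.eqb];
  repeat match goal with
  | H : ?r ?k = _ |- context [?r ?k] => is_var r; rewrite H
  end.

(** * Invariants and memory layout *)

Definition env (I : instance) (D best bestD : Z) (r : nat -> Z) : Prop :=
  (r r_zero = 0 /\ r r_one = 1 /\ r r_n = Z.of_nat (n_jobs I) /\
   r r_T1 = T1 I /\ r r_T2 = T2 I /\ r r_cap = deviation_cap I + 1) /\
  (r r_num = Qnum (mu I) /\ r r_den = Z.pos (Qden (mu I)) /\
   r r_P = Ptot I /\ r r_B = infeasible_cost I /\ r r_width = T1 I + 1) /\
  (r r_D = D /\ r r_best = best /\ r r_bestD = bestD /\ r r_minus = -1 /\
   r r_base = 6 + 2 * Z.of_nat (n_jobs I)).

Ltac split_env :=
  match goal with H : env _ _ _ _ _ |- _ =>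
    destruct H as ((? & ? & ? & ? & ? & ?) & (? & ? & ? & ? & ?) & (? & ? & ? & ? & ?))
  end.

(** The listed registers hold the parameters and the search state; all others are scratch. *)
Lemma env_ext I D best bestD r r' :
  env I D best bestD r ->
  Forall (fun k => r' k = r k) (seq 0 14 ++ [r_minus; r_base]) ->
  env I D best bestD r'.
Proof.
  intros H Hr. rewrite Forall_forall in Hr. unfold env in *.
  rewrite !Hr by (cbn; tauto). exact H.
Qed.

Ltac keep_env :=
  eapply env_ext; [eassumption|cbn [fold_left effect fst snd]; repeat constructor].

Definition cell (I : instance) (i : nat) (x : Z) : Z :=
  Z.of_nat i * (T1 I + 1) + x.

(** [k] grows while the schedule is written, since the output overwrites the inputs of jobs already
    done. *)
Definition inputs_from (I : instance) (k : nat) (m : Z -> Z) : Prop :=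
  forall j, (k <= j < n_jobs I)%nat ->
    m (6 + 2 * Z.of_nat j) = proc I j /\ m (7 + 2 * Z.of_nat j) = wgt I j.

(* Row i holds the states with i remaining jobs: costs at negative addresses,
   start times beyond the input.  Row 0 is never written, so it keeps the zeros
   of the initial memory. *)
Definition table (I : instance) (D : Z) (done : nat -> Z -> Prop) (m : Z -> Z) : Prop :=
  forall i x, done i x -> 0 <= x <= T1 I ->
    m (-1 - cell I i x) = fst (dp I (infeasible_cost I) D i x) /\
    m (6 + 2 * Z.of_nat (n_jobs I) + cell I i x)
    = snd (dp I (infeasible_cost I) D i x).

Definition rows (k : nat) (i : nat) (x : Z) : Prop := (i <= k)%nat.

Definition rows_upto (k : nat) (y : nat) (i : nat) (x : Z) : Prop :=
  (i <= k)%nat \/ i = S k /\ x < Z.of_nat y.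

Lemma cell_nonneg I i x : 0 <= T1 I -> 0 <= x -> 0 <= cell I i x.
Proof. intros. unfold cell. nia. Qed.

Lemma cell_inj I i x i' x' :
  0 <= x <= T1 I -> 0 <= x' <= T1 I -> cell I i x = cell I i' x' -> i = i' /\ x = x'.
Proof.
  unfold cell. intros Hx Hx' H.
  assert (~ Z.of_nat i < Z.of_nat i') by nia.
  assert (~ Z.of_nat i' < Z.of_nat i) by nia.
  assert (i = i') by lia. subst. lia.
Qed.

(** Row 0 is zero for every bound and is never written, so the memory left by one bound can serve as
    the initial memory for another. *)
Lemma table_row_0 I D D' m : table I D (rows 0) m -> table I D' (rows 0) m.
Proof.
  intros H i x Hi Hx. unfold rows in Hi. replace i with 0%nat by lia.
  exact (H 0%nat x (le_n _) Hx).
Qed.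

Ltac case_eqb :=
  match goal with |- context [?a =? ?b] => destruct (Z.eqb_spec a b) end.

Lemma table_store I D k y m v :
  0 <= T1 I -> (Z.of_nat y <= T1 I) ->
  table I D (rows_upto k y) m ->
  v = dp I (infeasible_cost I) D (S k) (Z.of_nat y) ->
  table I D (rows_upto k (S y))
    (upd_mem (upd_mem m (-1 - cell I (S k) (Z.of_nat y)) (fst v))
       (6 + 2 * Z.of_nat (n_jobs I) + cell I (S k) (Z.of_nat y)) (snd v)).
Proof.
  intros HT Hy Ht -> i x Hi Hx. unfold upd_mem.
  pose proof (cell_nonneg I i x HT ltac:(lia)).
  pose proof (cell_nonneg I (S k) (Z.of_nat y) HT ltac:(lia)).
  assert (Hcase : (i = S k /\ x = Z.of_nat y) \/
    (rows_upto k y i x /\ cell I i x <> cell I (S k) (Z.of_nat y))).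
  { unfold rows_upto in *.
    destruct (Z.eq_dec (cell I i x) (cell I (S k) (Z.of_nat y))) as [He|He].
    - left. apply cell_inj in He; auto; lia.
    - right. split; [|assumption]. destruct Hi as [?|[-> ?]]; [now left|right].
      split; [reflexivity|]. assert (x <> Z.of_nat y) by (intros ->; auto). lia. }
  destruct Hcase as [[-> ->]|[Hd Hne]].
  - split; repeat case_eqb; auto; lia.
  - destruct (Ht i x Hd Hx). split; repeat case_eqb; auto; lia.
Qed.

(** * Correctness of the table computation *)

Definition entry_pre (I : instance) (D best bestD : Z) (k y : nat) (r : nat -> Z) :=
  let j := (n_jobs I - S k)%nat in
  env I D best bestD r /\
  r r_i = Z.of_nat k /\ r r_x = Z.of_nat y /\ r r_C = Cstar I j /\
  r r_p = proc I j /\ r r_w = wgt I j.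

(** [e] is the cheapest option found so far for the entry, initially the dummy of cost [B]. *)
Definition scan (I : instance) (D best bestD : Z) (k y : nat)
    (e : Z * Z) (r : nat -> Z) : Prop :=
  entry_pre I D best bestD k y r /\
  r r_a = cell I k (Z.of_nat y) /\ r r_b = -1 - cell I k (Z.of_nat y) /\
  r r_cost = fst e /\ r r_start = snd e.

Ltac keep_scan :=
  unfold scan, entry_pre in *;
  repeat match goal with H : _ /\ _ |- _ => destruct H end;
  repeat match goal with |- _ /\ _ => split end;
  [keep_env| |..]; read_regs; auto.

Ltac run_do := apply within_do; [reflexivity|cbn; lia|].

Lemma keep_cheaper_within I D best bestD k y e r m t u :
  scan I D best bestD k y e r -> r r_t = t -> r r_u = u ->
  within keep_cheaper (r, m) 4 (fun s => snd s = m /\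
    scan I D best bestD k y
      (if u <? fst e then (u, t - proc I (n_jobs I - S k)) else e) (fst s)).
Proof.
  intros Hs Ht Hu. unfold keep_cheaper.
  pose proof Hs as ((HE & _ & _ & _ & Hp & _) & _ & _ & Hc & _).
  apply (within_if 2); [lia| |]; cbn [fst]; rewrite Hu, Hc; intros Hlt; run_do.
  - split; [reflexivity|]. replace (u <? fst e) with true by lia.
    destruct HE as ((H0 & _) & _).
    keep_scan. lia.
  - split; [reflexivity|]. replace (u <? fst e) with false by lia. exact Hs.
Qed.

Lemma try_late_within I D best bestD k y e r m v :
  let j := (n_jobs I - S k)%nat in
  let t := T2 I - Z.of_nat y in
  scan I D best bestD k y e r -> r r_t = t ->
  m (-1 - cell I k (Z.of_nat y)) = v ->
  within try_late (r, m) 10 (fun s => snd s = m /\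
    scan I D best bestD k y
      (if D <? t then e
       else let u := v + wgt I j * (t + Cstar I j) in
            if u <? fst e then (u, t + Cstar I j - proc I j) else e) (fst s)).
Proof.
  intros j t Hs Ht Hv. unfold try_late.
  pose proof Hs as ((HE & _ & _ & HC & _ & Hw) & _ & Hb & _).
  pose proof HE as (_ & _ & (HD & _)).
  apply (within_if 8); [lia| |]; cbn [fst]; rewrite Ht, HD; intros Hlt.
  - run_do. split; [reflexivity|]. now replace (D <? t) with true by lia.
  - replace (D <? t) with false by lia.
    eapply (within_seq 4 4); [lia|run_do|intros s' HR].
    + instantiate (1 := fun s => snd s = m /\ scan I D best bestD k y e (fst s) /\
        fst s r_t = t + Cstar I j /\ fst s r_u = v + wgt I j * (t + Cstar I j)).
      split; [reflexivity|]. split; [keep_scan|].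
      split; read_regs; reflexivity.
    + destruct s' as [r' m']. cbn [fst snd] in HR. destruct HR as (-> & Hs' & Ht' & Hu').
      cbv zeta. now apply keep_cheaper_within.
Qed.

(** The cost is read only if the early completion time is at most [T1]; otherwise [x + p] may leave
    the row, and its address would fall into another one. *)
Lemma try_early_within I D best bestD k y e r m v t :
  let j := (n_jobs I - S k)%nat in
  scan I D best bestD k y e r -> r r_t = t ->
  (t <= T1 I -> m (-1 - cell I k (Z.of_nat y + proc I j)) = v) ->
  within try_early (r, m) 10 (fun s => snd s = m /\
    scan I D best bestD k y
      (if T1 I <? t then e
       else let u := v + wgt I j * t in
            if u <? fst e then (u, t - proc I j) else e) (fst s)).
Proof.
  intros j Hs Ht Hv. unfold try_early.
  pose proof Hs as ((HE & _ & _ & _ & Hp & Hw) & _ & Hb & _).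
  pose proof HE as ((_ & _ & _ & HT1 & _) & _).
  apply (within_if 8); [lia| |]; cbn [fst]; rewrite Ht, HT1; intros Hlt.
  - run_do. split; [reflexivity|]. now replace (T1 I <? t) with true by lia.
  - replace (T1 I <? t) with false by lia. specialize (Hv Hlt).
    replace (-1 - cell I k (Z.of_nat y + proc I j))
      with (-1 - cell I k (Z.of_nat y) - proc I j) in Hv by (unfold cell; lia).
    eapply (within_seq 4 4); [lia|run_do|intros s' HR].
    + instantiate (1 := fun s => snd s = m /\ scan I D best bestD k y e (fst s) /\
        fst s r_t = t /\ fst s r_u = v + wgt I j * t).
      split; [reflexivity|]. split; [keep_scan|].
      split; read_regs; [reflexivity|]. fold j. now rewrite Hv.
    + destruct s' as [r' m']. cbn [fst snd] in HR. destruct HR as (-> & Hs' & Ht' & Hu').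
      cbv zeta. now apply keep_cheaper_within.
Qed.

Definition entry_inv (I : instance) (D best bestD : Z) (k y : nat) (s : store) : Prop :=
  entry_pre I D best bestD k y (fst s) /\ inputs_from I 0 (snd s) /\
  table I D (rows_upto k y) (snd s).

Lemma entry_within I D best bestD k y s :
  valid_instance I -> (k < n_jobs I)%nat -> Z.of_nat y <= T1 I ->
  entry_inv I D best bestD k y s ->
  within entry_cmd s 40 (entry_inv I D best bestD k (S y)).
Proof.
  intros HI Hk Hy. destruct s as [r m]. intros (Hpre & Hin & Htab). cbn [fst snd] in *.
  pose proof (T1_T2 I HI) as HT.
  set (j := (n_jobs I - S k)%nat). set (x := Z.of_nat y) in *.
  assert (Hj : (j < n_jobs I)%nat) by lia.
  pose proof (proc_pos I HI j Hj) as Hp.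
  set (f := fun z => fst (dp I (infeasible_cost I) D k z)).
  assert (Hf : forall z, 0 <= z <= T1 I -> m (-1 - cell I k z) = f z).
  { intros z Hz. apply Htab; [|assumption]. left. lia. }
  unfold entry_cmd.
  apply (within_seq 6 34 (fun s => snd s = m /\
    scan I D best bestD k y (infeasible_cost I, 0) (fst s) /\
    fst s r_t = T2 I - x)); [lia|run_do|].
  { pose proof Hpre as (HE & Hi & Hx & _).
    pose proof HE as ((H0 & _ & _ & _ & HT2 & _) & (_ & _ & _ & HB & Hwd)
                      & (_ & _ & _ & Hmin & _)).
    split; [reflexivity|]. split; [|read_regs; reflexivity].
    keep_scan; unfold cell; fold x; ring. }
  clear Hpre r. intros [r m'] (Hm & Hs & Ht). cbn [fst snd] in *. subst m'.
  eapply (within_seq 10 24); [lia| |].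
  { apply (try_late_within I D best bestD k y _ r m (f x) Hs Ht).
    apply Hf. lia. }
  fold j x.
  match goal with |- context [scan _ _ _ _ _ _ ?e' _] => set (e := e') end.
  clear Hs Ht r. intros [r m'] (Hm & Hs). cbn [fst snd] in *. subst m'.
  set (t := Z.max (x + proc I j) (Cstar I j - D)).
  apply (within_seq 2 22 (fun s => snd s = m /\
    scan I D best bestD k y e (fst s) /\ fst s r_t = Cstar I j - D
    /\ fst s r_u = x + proc I j)); [lia|run_do|].
  { pose proof Hs as ((HE & _ & Hx & HC & Hpr & _) & _).
    pose proof HE as (_ & _ & (HD & _)).
    split; [reflexivity|]. split; [keep_scan|].
    split; read_regs; reflexivity. }
  clear Hs r. intros [r m'] (Hm & Hs & Ht & Hu). cbn [fst snd] in *. subst m'.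
  apply (within_seq 4 18 (fun s => snd s = m /\
    scan I D best bestD k y e (fst s) /\ fst s r_t = t)); [lia| |].
  { pose proof Hs as ((HE & _) & _). pose proof HE as ((H0 & _) & _).
    apply (within_if 2); [lia| |]; cbn [fst]; rewrite Ht, Hu; intros Hlt; run_do.
    - split; [reflexivity|]. split; [keep_scan|]. read_regs. unfold t. lia.
    - split; [reflexivity|]. split; [exact Hs|]. cbn. rewrite Ht. unfold t. lia. }
  clear Hs Ht Hu r. intros [r m'] (Hm & Hs & Ht). cbn [fst snd] in *. subst m'.
  eapply (within_seq 10 8); [lia| |].
  { apply (try_early_within I D best bestD k y _ r m (f (x + proc I j)) t Hs Ht).
    intros Hle. apply Hf. unfold t in Hle. lia. }
  cbv zeta. fold j.
  (* The program tests in the order of [dp_entry], so the accumulated conditional is convertible to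
     the table entry. *)
  match goal with |- context [scan _ _ _ _ _ _ ?e' _] =>
    change e' with (dp I (infeasible_cost I) D (S k) x) end.
  set (v := dp _ _ _ (S k) x).
  clear Hs Ht r. intros [r m'] (Hm & Hs). cbn [fst snd] in *. subst m'.
  run_do.
  destruct Hs as (Hpre & Ha & Hb & Hc & Hst).
  pose proof Hpre as (HE & Hi & Hx & HC & Hpr & Hwt).
  pose proof HE as ((_ & H1 & _) & (_ & _ & _ & _ & Hwd) & (_ & _ & _ & _ & Hbase)).
  assert (Hmem : snd (fold_left effect
      [Isub r_b r_b r_width; Istore r_b r_cost; Iadd r_a r_a r_width;
       Iadd r_a r_a r_base; Istore r_a r_start; Iadd r_x r_x r_one] (r, m))
    = upd_mem (upd_mem m (-1 - cell I (S k) x) (fst v))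
       (6 + 2 * Z.of_nat (n_jobs I) + cell I (S k) x) (snd v)).
  { read_regs. f_equal; [f_equal|]; unfold cell; lia. }
  unfold entry_inv. rewrite Hmem. clear Hmem. split; [|split].
  - unfold entry_pre. split; [keep_env|]. repeat split; read_regs; auto; lia.
  - intros i Hi'. destruct (Hin i Hi') as [HA HB].
    pose proof (cell_nonneg I (S k) x ltac:(lia) ltac:(lia)).
    unfold upd_mem. repeat case_eqb; auto; lia.
  - apply table_store; auto; lia.
Qed.

Definition row_inv (I : instance) (D best bestD : Z) (k : nat) (s : store) : Prop :=
  (env I D best bestD (fst s) /\ fst s r_i = Z.of_nat k /\
   fst s r_C = Sstar I (n_jobs I - k)) /\
  inputs_from I 0 (snd s) /\ table I D (rows k) (snd s).

Lemma row_within I D best bestD k s :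
  valid_instance I -> (k < n_jobs I)%nat ->
  row_inv I D best bestD k s ->
  within row_cmd s (42 * (T1 I + 1) + 12) (row_inv I D best bestD (S k)).
Proof.
  intros HI Hk. destruct s as [r m]. intros ((HE & Hi & HC) & Hin & Htab).
  cbn [fst snd] in *. pose proof (T1_T2 I HI) as HT.
  set (j := (n_jobs I - S k)%nat).
  assert (Hjn : (n_jobs I - k)%nat = S j) by lia. rewrite Hjn, Sstar_S in HC.
  unfold row_cmd.
  apply (within_seq 8 (42 * (T1 I + 1) + 4) (entry_inv I D best bestD k 0));
    [lia|run_do|].
  { destruct (Hin j ltac:(lia)) as [Hpj Hwj].
    replace (7 + 2 * Z.of_nat j) with (6 + 2 * Z.of_nat j + 1) in Hwj by lia.
    pose proof HE as ((_ & H1 & Hn & _) & _).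
    assert (Ha : Z.of_nat (n_jobs I) - Z.of_nat k + (Z.of_nat (n_jobs I) - Z.of_nat k) + 4
      = 6 + 2 * Z.of_nat j) by lia.
    split; [|split].
    - split; [keep_env|]. repeat split; read_regs; auto.
      + now rewrite Ha.
      + now rewrite Ha.
    - exact Hin.
    - intros i x [Hx|[_ Hx]] Hx'; [|lia]. now apply Htab. }
  intros s' Hs'.
  apply (within_seq (42 * (T1 I + 1) + 2) 2
    (entry_inv I D best bestD k (Z.to_nat (T1 I + 1)))); [lia| |].
  - eapply within_weaken.
    + apply (within_while (entry_inv I D best bestD k) r_x r_width entry_cmd 40
               (Z.to_nat (T1 I + 1)) 0 s' Hs').
      * intros y s1 Hy Hs1. split.
        -- destruct Hs1 as ((((_ & _) & (_ & _ & _ & _ & Hwd) & _) & _ & Hx & _) & _).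
           lia.
        -- apply entry_within; auto. lia.
      * intros s1 ((((_ & _) & (_ & _ & _ & _ & Hwd) & _) & _ & Hx & _) & _). lia.
    + lia.
    + auto.
  - clear s' Hs' r m HE Hi HC Hin Htab. intros [r m] (Hpre & Hin & Htab).
    cbn [fst snd] in *. destruct Hpre as (HE & Hi & _ & HC & Hp & _).
    pose proof HE as ((_ & H1 & _) & _). run_do.
    split; [|split]; [|exact Hin|].
    + split; [keep_env|]. split; read_regs; [lia|]. fold j.
      rewrite Cstar_eq. lia.
    + intros i x Hx Hx'. apply Htab; [|assumption]. unfold rows, rows_upto in *. lia.
Qed.

Definition dp_time (I : instance) : Z :=
  Z.of_nat (n_jobs I) * (42 * (T1 I + 1) + 14) + 4.

Definition ready (I : instance) (D best bestD : Z) (s : store) : Prop :=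
  env I D best bestD (fst s) /\ inputs_from I 0 (snd s) /\
  table I D (rows 0) (snd s).

Lemma dp_within I D best bestD s :
  valid_instance I -> ready I D best bestD s ->
  within dp_cmd s (dp_time I) (fun s' => env I D best bestD (fst s') /\
    inputs_from I 0 (snd s') /\ table I D (rows (n_jobs I)) (snd s')).
Proof.
  intros HI. destruct s as [r m]. intros (HE & Hin & Htab). cbn [fst snd] in *.
  unfold dp_cmd, dp_time.
  apply (within_seq 2 (Z.of_nat (n_jobs I) * (42 * (T1 I + 1) + 12 + 2) + 2)
           (row_inv I D best bestD 0)); [lia|run_do|].
  - pose proof HE as ((H0 & _) & (_ & _ & HP & _) & _).
    split; [|now split]. split; [keep_env|]. split; read_regs; [reflexivity|].
    rewrite Nat.sub_0_r. unfold Ptot, Sstar. lia.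
  - intros s' Hs'. eapply within_weaken.
    + apply (within_while (row_inv I D best bestD) r_i r_n row_cmd
               (42 * (T1 I + 1) + 12)
               (n_jobs I) 0 s' Hs').
      * intros k s1 Hk Hs1. split; [|apply row_within; auto; lia].
        destruct Hs1 as ((((_ & _ & Hn & _) & _) & Hi & _) & _). lia.
      * intros s1 ((((_ & _ & Hn & _) & _) & Hi & _) & _). lia.
    + lia.
    + intros s1 ((HE1 & _) & Hin1 & Htab1). auto.
Qed.

(** * Search over the deviation bound *)

Definition search_inv (I : instance) (d : nat) (s : store) : Prop :=
  exists best bestD,
    ready I (Z.of_nat d) best bestD s /\
    0 <= bestD <= deviation_cap I /\
    (forall D, 0 <= D < Z.of_nat d -> best <= scaled_objective I D) /\
    (best = scaled_objective I bestD \/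
     best = Z.pos (Qden (mu I)) * infeasible_cost I).

Lemma search_within I d s :
  valid_instance I -> Z.of_nat d <= deviation_cap I ->
  search_inv I d s ->
  within search_cmd s (dp_time I + 11) (search_inv I (S d)).
Proof.
  intros HI Hd (best & bestD & Hready & HbD & Hmin & Hbest).
  pose proof (T1_T2 I HI) as HT. unfold search_cmd.
  eapply (within_seq (dp_time I) 11); [lia|apply dp_within; eassumption|].
  clear s Hready. intros [r m] (HE & Hin & Htab). cbn [fst snd] in *.
  set (obj := scaled_objective I (Z.of_nat d)).
  apply (within_seq 6 5 (fun s => snd s = m /\ env I (Z.of_nat d) best bestD (fst s)
    /\ fst s r_a = obj)); [lia|run_do|].
  { pose proof HE as ((_ & _ & Hn & _) & (Hnum & Hden & _ & _ & Hwd)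
                      & (HD & _ & _ & Hmin1 & _)).
    split; [reflexivity|]. split; [keep_env|]. read_regs.
    destruct (Htab (n_jobs I) 0 (le_n _) ltac:(lia)) as [Hv _].
    unfold obj, scaled_objective. rewrite <- Hv. unfold cell.
    now rewrite Z.add_0_r. }
  clear HE r. intros [r m'] (Hm & HE & Ha). cbn [fst snd] in *. subst m'.
  assert (Htab0 : forall D, table I D (rows 0) m).
  { intros D. apply (table_row_0 I (Z.of_nat d)). intros i x Hi Hx.
    apply Htab; [unfold rows in *; lia|assumption]. }
  apply (within_seq 4 1 (fun s => exists best bestD,
    snd s = m /\ env I (Z.of_nat d) best bestD (fst s) /\
    0 <= bestD <= deviation_cap I /\
    (forall D, 0 <= D <= Z.of_nat d -> best <= scaled_objective I D) /\
    (best = scaled_objective I bestD \/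
     best = Z.pos (Qden (mu I)) * infeasible_cost I))); [lia| |].
  - assert (Hsplit : forall D, 0 <= D <= Z.of_nat d ->
      D = Z.of_nat d \/ 0 <= D < Z.of_nat d) by lia.
    pose proof HE as HE'. split_env.
    apply (within_if 2); [lia| |]; cbn [fst]; rewrite Ha;
      match goal with H : r r_best = _ |- _ => rewrite H end; intros Hlt; run_do.
    + exists obj, (Z.of_nat d). split; [reflexivity|].
      split; [|split; [lia|split; [|now left]]].
      * unfold env. repeat split; read_regs; auto; lia.
      * intros D HD. destruct (Hsplit D HD) as [->|HD']; [apply Z.le_refl|].
        specialize (Hmin D HD'). lia.
    + exists best, bestD. split; [reflexivity|]. repeat split; auto; try lia; try apply HE'.
      intros D HD. destruct (Hsplit D HD) as [->|HD']; [assumption|auto].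
  - clear best bestD HbD Hmin Hbest HE Ha r.
    intros [r m'] (best & bestD & Hm & HE & HbD & Hmin & Hbest).
    cbn [fst snd] in *. subst m'. run_do.
    exists best, bestD. split; [|split; [assumption|split; [|assumption]]].
    + split; [|split; [exact Hin|apply Htab0]]. split_env. unfold env.
      repeat split; read_regs; auto; lia.
    + intros D HD. apply Hmin. lia.
Qed.

(** * Writing out the schedule *)

Definition trace_inv (I : instance) (D best bestD : Z) (j : nat) (s : store) : Prop :=
  let B := infeasible_cost I in
  (env I D best bestD (fst s) /\ fst s r_i = Z.of_nat j /\
   fst s r_x = trace_load I B D j /\
   fst s r_C = Z.of_nat (n_jobs I - j) * (T1 I + 1)) /\
  inputs_from I j (snd s) /\ table I D (rows (n_jobs I)) (snd s) /\
  (forall i, (i < j)%nat -> snd s (Z.of_nat i) = trace_start I B D i).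

Lemma trace_within I D best bestD j s :
  valid_instance I -> (j < n_jobs I)%nat ->
  0 <= trace_load I (infeasible_cost I) D j <= T1 I ->
  trace_inv I D best bestD j s ->
  within trace_cmd s 14 (trace_inv I D best bestD (S j)).
Proof.
  intros HI Hj Hx. destruct s as [r m]. intros ((HE & Hi & Hrx & HC) & Hin & Htab & Hout).
  cbn [fst snd] in *. pose proof (T1_T2 I HI) as HT. unfold trace_cmd.
  set (B := infeasible_cost I) in *. set (x := trace_load I B D j) in *.
  set (st := trace_start I B D j).
  set (m1 := upd_mem m (Z.of_nat j) st).
  apply (within_seq 10 4 (fun s => snd s = m1 /\ env I D best bestD (fst s) /\
    fst s r_i = Z.of_nat (S j) /\ fst s r_x = x /\
    fst s r_C = Z.of_nat (n_jobs I - S j) * (T1 I + 1) /\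
    fst s r_p = proc I j /\ fst s r_start = st)); [lia|run_do|].
  - destruct (Hin j ltac:(lia)) as [Hp _].
    destruct (Htab (n_jobs I - j)%nat x ltac:(unfold rows; lia) Hx) as [_ Hs].
    fold st in Hs. unfold cell in Hs. rewrite Z.add_assoc in Hs.
    pose proof HE as ((_ & H1 & _) & (_ & _ & _ & _ & Hwd) & (_ & _ & _ & _ & Hbase)).
    assert (Ha : Z.of_nat j + Z.of_nat j + 6 = 6 + 2 * Z.of_nat j) by lia.
    split; [read_regs; reflexivity|].
    split; [keep_env|]. repeat split; read_regs; auto; try lia.
    + replace (n_jobs I - j)%nat with (S (n_jobs I - S j)) by lia. lia.
    + now rewrite Ha.
  - assert (Hmem : inputs_from I (S j) m1 /\ table I D (rows (n_jobs I)) m1 /\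
      (forall i, (i < S j)%nat -> m1 (Z.of_nat i) = trace_start I B D i)).
    { unfold m1, upd_mem. split; [|split].
      - intros i Hi'. destruct (Hin i ltac:(lia)) as [H1 H2].
        repeat case_eqb; auto; lia.
      - intros i y Hi' Hy. destruct (Htab i y Hi' Hy) as [H1 H2].
        pose proof (cell_nonneg I i y ltac:(lia) ltac:(lia)).
        repeat case_eqb; auto; lia.
      - intros i Hi'. case_eqb; [|apply Hout; lia].
        now replace i with j by lia. }
    clear HE Hi Hrx HC Hin Htab Hout r.
    intros [r m'] (Hm & HE & Hi & Hrx & HC & Hp & Hst). cbn [fst snd] in *. subst m'.
    assert (Hload : trace_load I B D (S j) = if st <? T2 I then x + proc I j else x)
      by reflexivity.
    pose proof HE as ((_ & _ & _ & _ & HT2 & _) & _).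
    apply (within_if 2); [lia| |]; cbn [fst]; rewrite Hst, HT2; intros Hlt; run_do.
    + replace (st <? T2 I) with true in Hload by lia.
      split; [|exact Hmem]. split; [keep_env|]. fold B. rewrite Hload.
      repeat split; read_regs; auto.
    + replace (st <? T2 I) with false in Hload by lia.
      split; [|exact Hmem]. cbn [fold_left fst]. fold B. now rewrite Hload.
Qed.

(** * Input and setup *)

Lemma input_mem_job I j : (j < n_jobs I)%nat ->
  input_mem I (6 + 2 * Z.of_nat j) = proc I j /\
  input_mem I (7 + 2 * Z.of_nat j) = wgt I j.
Proof.
  intros Hj. unfold input_mem.
  split.
  - do 6 (case_eqb; [lia|]).
    replace (_ && _) with true
      by (symmetry; apply andb_true_intro; split; [apply Z.leb_le|apply Z.ltb_lt]; lia).
    replace (Z.even _) with true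
      by (replace (6 + 2 * Z.of_nat j) with (2 * (3 + Z.of_nat j)) by lia;
          now rewrite Z.even_mul).
    replace (6 + 2 * Z.of_nat j - 6) with (Z.of_nat j * 2) by lia.
    now rewrite Z.div_mul, Nat2Z.id by lia.
  - do 6 (case_eqb; [lia|]).
    replace (_ && _) with true
      by (symmetry; apply andb_true_intro; split; [apply Z.leb_le|apply Z.ltb_lt]; lia).
    replace (Z.even _) with false
      by (replace (7 + 2 * Z.of_nat j) with (2 * (3 + Z.of_nat j) + 1) by lia;
          now rewrite Z.even_add, Z.even_mul).
    replace (7 + 2 * Z.of_nat j - 6) with (1 + Z.of_nat j * 2) by lia.
    rewrite Z.div_add by lia. now rewrite Z.add_0_l, Nat2Z.id.
Qed.

Lemma input_mem_outside I a :
  a < 0 \/ 6 + 2 * Z.of_nat (n_jobs I) <= a -> input_mem I a = 0.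
Proof.
  intros Ha. unfold input_mem. do 6 (case_eqb; [lia|]).
  destruct (Z.leb_spec 6 a), (Z.ltb_spec a (6 + 2 * Z.of_nat (n_jobs I)));
    simpl; auto; lia.
Qed.

Definition sum_inv (I : instance) (j : nat) (s : store) : Prop :=
  let (r, m) := s in
  (m = input_mem I /\ r r_zero = 0 /\ r r_one = 1 /\ r r_n = Z.of_nat (n_jobs I) /\
   r r_T1 = T1 I /\ r r_T2 = T2 I /\ r r_cap = kbound I) /\
  (r r_num = Qnum (mu I) /\ r r_den = Z.pos (Qden (mu I)) /\
   r r_width = T1 I + 1 /\ r r_D = 0 /\ r r_bestD = 0 /\ r r_minus = -1 /\
   r r_base = 6 + 2 * Z.of_nat (n_jobs I)) /\
  (r r_a = 6 + 2 * Z.of_nat j /\ r r_P = zsum (proc I) j /\ r r_B = zsum (wgt I) j).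

Lemma sum_within I j s :
  (j < n_jobs I)%nat -> sum_inv I j s -> within sum_cmd s 6 (sum_inv I (S j)).
Proof.
  intros Hj. destruct s as [r m].
  intros ((-> & ? & H1 & ? & ? & ? & ?) & (? & ? & ? & ? & ? & ? & ?) & (Ha & HP & HB)).
  destruct (input_mem_job I j Hj) as [Hp Hw].
  replace (7 + 2 * Z.of_nat j) with (6 + 2 * Z.of_nat j + 1) in Hw by lia.
  run_do. cbn [fold_left effect]. unfold sum_inv.
  repeat split; read_regs; rewrite ?Hp, ?Hw; auto; lia.
Qed.

Lemma setup_within I :
  valid_instance I -> 0 <= kbound I ->
  within setup_cmd (fun _ => 0, input_mem I) (Z.of_nat (n_jobs I) * 8 + 28)
    (search_inv I 0).
Proof.
  intros HI Hk. unfold setup_cmd.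
  pose proof (T1_T2 I HI) as HT.
  assert (HP : 0 <= Ptot I) by (apply (Sstar_nonneg I HI); lia).
  apply (within_seq 16 (Z.of_nat (n_jobs I) * 8 + 12) (sum_inv I 0)); [lia|run_do|].
  { cbn [fold_left effect]. unfold sum_inv. repeat split; try reflexivity.
    cbv beta iota delta [upd_reg Nat.eqb]. cbn [input_mem Z.eqb]. lia. }
  intros s Hs.
  apply (within_seq (Z.of_nat (n_jobs I) * 8 + 2) 10 (sum_inv I (n_jobs I)));
    [lia| |].
  { eapply within_weaken.
    - apply (within_while (sum_inv I) r_a r_base sum_cmd 6 (n_jobs I) 0 s Hs).
      + intros j [r m] Hj Hs1. split; [|apply sum_within; auto; lia].
        destruct Hs1 as (_ & (_ & _ & _ & _ & _ & _ & Hb) & (Ha & _)). cbn [fst]. lia.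
      + intros [r m] (_ & (_ & _ & _ & _ & _ & _ & Hb) & (Ha & _)). cbn [fst]. lia.
    - lia.
    - auto. }
  clear s Hs. intros [r m].
  intros ((-> & H0 & H1 & ? & ? & ? & ?) & (? & ? & ? & ? & ? & ? & ?) & (Ha & HrP & HrB)).
  set (best := Z.pos (Qden (mu I)) * infeasible_cost I).
  (* [env] prescribes the final [r_cap], which is computed last; until then it is claimed for the
     registers with that one value replaced. *)
  set (with_cap := fun r => upd_reg r r_cap (deviation_cap I + 1)).
  apply (within_seq 5 5 (fun s => snd s = input_mem I /\
    env I 0 best 0 (with_cap (fst s)) /\
    fst s r_cap = kbound I /\ fst s r_b = T2 I + Ptot I)); [lia|run_do|].
  { split; [reflexivity|]. unfold with_cap, env.
    repeat split; read_regs; auto; try lia. }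
  clear - HI Hk HT HP.
  intros [r m] (Hm & HE & Hc & Hb). cbn [fst snd] in *. subst m.
  apply (within_seq 4 1 (fun s => snd s = input_mem I /\
    env I 0 best 0 (with_cap (fst s)) /\ fst s r_cap = deviation_cap I)); [lia| |].
  { pose proof HE as ((H0 & _) & _). cbn in H0. unfold deviation_cap.
    apply (within_if 2); [lia| |]; cbn [fst]; rewrite Hc, Hb; intros Hlt; run_do.
    - split; [reflexivity|]. split; [exact HE|]. cbn. lia.
    - split; [reflexivity|]. split; [unfold with_cap in *; keep_env|].
      read_regs. lia. }
  clear HE Hc Hb r. intros [r m] (Hm & HE & Hc). cbn [fst snd] in *. subst m.
  pose proof HE as ((_ & H1 & _) & _). cbn in H1. run_do.
  exists best, 0. split; [|split; [|split; [lia|now right]]].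
  - split; [|split].
    + eapply env_ext; [exact HE|]. unfold with_cap. cbn [fold_left effect fst snd].
      repeat constructor. read_regs. reflexivity.
    + intros j Hj. apply input_mem_job. lia.
    (* The addresses of row 0 lie outside the input, where memory is 0. *)
    + intros i x Hi Hx. unfold rows in Hi. replace i with 0%nat by lia.
      unfold cell. cbn [fold_left effect snd dp fst].
      split; apply input_mem_outside; lia.
  - unfold deviation_cap. lia.
Qed.

(** * The complete solver and its running time *)

(** The search takes [deviation_cap I + 1] rounds, and the extra one pays for rerunning the dynamic
    program at the best bound. Setup and tracing are linear in [n]. *)
Definition solver_time (I : instance) : Z :=
  (dp_time I + 13) * (deviation_cap I + 2) + 24 * Z.of_nat (n_jobs I) + 40.

Lemma solver_within I :
  valid_instance I -> (exists tau, feasible I tau) ->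
  within solver (fun _ => 0, input_mem I) (solver_time I)
    (fun s => optimal I (fun j => IZR (snd s (Z.of_nat j)))).
Proof.
  intros HI Hfeas. pose proof (T1_T2 I HI) as HT.
  assert (HP : 0 <= Ptot I) by (apply (Sstar_nonneg I HI); lia).
  assert (Hk : 0 <= kbound I).
  { destruct Hfeas as [tau [_ Hk]]. apply le_IZR.
    eapply Rle_trans; [apply Rmaxn_nonneg|exact Hk]. }
  assert (Hcap : 0 <= deviation_cap I) by (unfold deviation_cap; lia).
  assert (Hdp : 0 <= dp_time I) by (unfold dp_time; nia).
  set (ncap := Z.to_nat (deviation_cap I + 1)).
  unfold solver, solver_time.
  apply (within_seq (Z.of_nat (n_jobs I) * 8 + 28)
           ((deviation_cap I + 2) * (dp_time I + 13) + 16 * Z.of_nat (n_jobs I) + 12)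
           (search_inv I 0)); [lia|now apply setup_within|].
  intros s Hs.
  eapply (within_seq ((deviation_cap I + 1) * (dp_time I + 13) + 2)
            (dp_time I + 16 * Z.of_nat (n_jobs I) + 10)
            (search_inv I ncap)); [lia| |].
  { eapply within_weaken.
    - apply (within_while (search_inv I) r_D r_cap search_cmd (dp_time I + 11)
               ncap 0 s Hs).
      + intros d s1 Hd Hs1. split; [|apply search_within; auto; lia].
        destruct Hs1 as (best & bestD & (HE & _) & _). split_env. lia.
      + intros s1 (best & bestD & (HE & _) & _). split_env. lia.
    - lia.
    - auto. }
  clear s Hs. intros [r m] (best & bestD & Hready & HbD & Hmin & Hbest).
  destruct (best_trace_optimal I HI best bestD Hfeas HbD) as [Hload Hopt].
  { intros D HD. apply Hmin. lia. }
  { lia. }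
  (* Memory holds the table of the last bound tried, so the table is rebuilt for [bestD]. *)
  apply (within_seq 1 (dp_time I + 16 * Z.of_nat (n_jobs I) + 9)
           (ready I bestD best bestD)); [lia|run_do|].
  { destruct Hready as (HE & Hin & Htab). cbn [fst snd] in *.
    split; [|split; [exact Hin|exact (table_row_0 _ _ _ _ Htab)]].
    split_env. unfold env. repeat split; read_regs; auto; lia. }
  clear r m Hready. intros s Hready.
  eapply (within_seq (dp_time I) (16 * Z.of_nat (n_jobs I) + 9));
    [lia|apply dp_within; eassumption|].
  clear s Hready. intros [r m] (HE & Hin & Htab). cbn [fst snd] in *.
  apply (within_seq 3 (16 * Z.of_nat (n_jobs I) + 6) (trace_inv I bestD best bestD 0));
    [lia|run_do|].
  { pose proof HE as ((_ & _ & Hn & _) & (_ & _ & _ & _ & Hwd) & _).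
    split; [|split; [exact Hin|split; [exact Htab|lia]]].
    split; [keep_env|]. repeat split; read_regs; auto. now rewrite Nat.sub_0_r. }
  intros s Hs. eapply within_weaken.
  - apply (within_while (trace_inv I bestD best bestD) r_i r_n trace_cmd 14
             (n_jobs I) 0 s Hs).
    + intros j s1 Hj Hs1. split.
      * destruct Hs1 as ((((_ & _ & Hn & _) & _) & Hi & _) & _). lia.
      * apply trace_within; auto; [lia|]. apply Hload. lia.
    + intros s1 ((((_ & _ & Hn & _) & _) & Hi & _) & _). lia.
  - lia.
  - intros s1 (_ & _ & _ & Hout). apply Hopt. intros j Hj. f_equal. now apply Hout.
Qed.

Lemma zmaxn_ge f m j : (j < m)%nat -> f j <= zmaxn f m.
Proof.
  induction m; intros Hj; [lia|]. simpl.
  destruct (Nat.eq_dec j m) as [->|]; [lia|]. specialize (IHm ltac:(lia)). lia.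
Qed.

(** The claimed bound has a spare factor [n ^ 2 * wmax I], which is at least 1. The constants add up
    to 345 + 24 + 40, well below 1000. *)
Lemma solver_time_le I :
  valid_instance I -> 0 <= kbound I -> solver_time I <= 1000 * time_bound I.
Proof.
  intros HI Hk. pose proof (T1_T2 I HI) as HT.
  assert (HP : 0 <= Ptot I) by (apply (Sstar_nonneg I HI); lia).
  destruct HI as (Hpos & _ & _ & _ & _ & (j & Hj & HpT) & _).
  destruct (Hpos j Hj) as [Hp Hw]. pose proof (zmaxn_ge (wgt I) _ j Hj) as Hwm.
  fold (wmax I) in Hwm.
  unfold solver_time, dp_time, time_bound.
  set (n := Z.of_nat (n_jobs I)). assert (Hn : 1 <= n) by lia.
  set (L := T2 I + Ptot I). assert (HL : 1 <= L) by lia.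
  assert (Hcap : deviation_cap I <= L) by (unfold deviation_cap; lia).
  assert (Hcap0 : 0 <= deviation_cap I) by (unfold deviation_cap; lia).
  set (t := T1 I) in *. assert (Ht : 1 <= t) by lia.
  (* Some job fits before [T1], so [t] is at least 1. Then [42 * (t + 1) + 14 <= 98 * t], and 98 +
     17 = 115. *)
  assert (Hnt : n * (42 * (t + 1) + 14) + 17 <= 115 * (n * t)) by nia.
  (* The factor [deviation_cap I + 2] is at most [3 * L], which turns 115 into 345. *)
  assert (Hprod : (n * (42 * (t + 1) + 14) + 4 + 13) * (deviation_cap I + 2)
    <= 345 * (n * t * L)) by nia.
  assert (HntL : n <= n * t * L) by nia.
  assert (Hmain : n * t * L <= n ^ 3 * t * wmax I * L).
  { replace (n ^ 3 * t * wmax I * L) with ((n * n * wmax I) * (n * t * L)) by ring.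
    assert (1 <= n * n * wmax I) by nia. nia. }
  lia.
Qed.

Theorem theorem5 :
  exists (prog : list instr) (c : Z),
    forall I : instance,
      valid_instance I ->
      (exists sigma, feasible I sigma) ->
      exists (t : nat) (f : mstate),
        halts_in prog t (init_state I) f /\
        (Z.of_nat t <= c * time_bound I)%Z /\
        optimal I (output_schedule f).
Proof.
  exists (compile solver 0), 1000. intros I HI Hfeas.
  destruct (solver_within I HI Hfeas) as (t & s & Hexec & Ht & Hopt).
  exists t, (at_pc (length (compile solver 0)) s).
  split; [exact (compile_halts _ _ _ _ Hexec)|]. split; [|exact Hopt].
  eapply Z.le_trans; [exact Ht|]. apply solver_time_le; [assumption|].
  destruct Hfeas as [tau [_ Hk]]. apply le_IZR.
  eapply Rle_trans; [apply Rmaxn_nonneg|exact Hk].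
Qed.
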